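(* Let $m\ge2$ and let $U$ be a non-projective uniserial module over a left $m$-multiserial algebra $\Lambda$. Then $\alpha(U)\le m$.
   Context: $\Lambda$ is a finite-dimensional algebra over a field $K$, with Jacobson radical $J$; modules are finitely generated left modules. $\Lambda$ is left $m$-multiserial if, for each primitive idempotent $e$ of $\Lambda$, the left ideal $Je$ is a sum of $m$ uniserial $\Lambda$-modules. A module is uniserial if it has only one composition series with simple factors. For a non-projective uniserial module $U$, $\alpha(U)$ denotes the number of indecomposable summands in a decomposition into indecomposables of the middle term $B$ of the almost split sequence $0\to DTrU\to B\to U\to0$ ending in $U$. *)

(* Defs.v *)
From HB Require Import structures.
From mathcomp Require Import all_boot all_algebra all_field.
From mathcomp Require Import boolp classical_sets.

Set Implicit Arguments.
Unset Strict Implicit.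
Unset Printing Implicit Defensive.

Import GRing.Theory.

Local Open Scope classical_set_scope.
Local Open Scope ring_scope.

Section Submodules.
Variables (R : nzRingType) (V : lmodType R).
Implicit Types S T P Q : set V.

Definition submodule S : Prop := GRing.submod_closed [in S].

Definition maximal_submodule S : Prop :=
  [/\ submodule S, S != setT &
    forall T, submodule T -> S `<=` T -> T = S \/ T = setT].

(* For submodules S of T, the submodules of T / S correspond to the
   submodules of V between S and T: this says that T / S is a simple module. *)
Definition simple_factor S T : Prop :=
  [/\ submodule S, submodule T, S `<` T &
    forall Q, submodule Q -> S `<=` Q -> Q `<=` T -> Q = S \/ Q = T].

(* s lists the terms of the series after the initial term 0. *)
Definition composition_series S (s : seq (set V)) : Prop :=
  path (fun P Q => `[< simple_factor P Q >]) [set 0] s /\ last [set 0] s = S.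

Definition uniserial_submodule S : Prop :=
  submodule S /\ exists! s : seq (set V), composition_series S s.

Definition indecomposable_submodule S : Prop :=
  [/\ submodule S, S != [set 0] &
    forall P Q, submodule P -> submodule Q ->
      [set x + y | x in P & y in Q] = S -> P `&` Q = [set 0] ->
      P = [set 0] \/ Q = [set 0]].

Definition sum_submodules n (W : 'I_n -> set V) : set V :=
  [set \sum_i w i | w in [set w : 'I_n -> V | forall i, W i (w i)]].

Definition independent_submodules n (W : 'I_n -> set V) : Prop :=
  forall w : 'I_n -> V,
    (forall i, W i (w i)) -> \sum_i w i = 0 -> forall i, w i = 0.

End Submodules.

Section Modules.
Variables (R : nzRingType).
Implicit Types M N P U X Y B : lmodType R.

Definition finitely_generated M : Prop :=
  exists (n : nat) (g : 'I_n -> M),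
    forall x, exists a : 'I_n -> R, x = \sum_i a i *: g i.

Definition uniserial M : Prop := uniserial_submodule [set: M].

Definition projective P : Prop :=
  forall M N (p : {linear M -> N}) (f : {linear P -> N}),
    (forall y, exists x, p x = y) ->
    exists h : {linear P -> M}, forall x, p (h x) = f x.

Definition indecomposable_decomposition M n (W : 'I_n -> set M) : Prop :=
  [/\ forall i, indecomposable_submodule (W i),
      sum_submodules W = [set: M] &
      independent_submodules W].

Definition split_epi M N (g : {linear M -> N}) : Prop :=
  exists s : {linear N -> M}, forall y, g (s y) = y.

Definition split_mono M N (f : {linear M -> N}) : Prop :=
  exists r : {linear N -> M}, forall x, r (f x) = x.

Definition right_almost_split B U (g : {linear B -> U}) : Prop :=
  ~ split_epi g /\
  forall Y (h : {linear Y -> U}), finitely_generated Y -> ~ split_epi h ->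
    exists k : {linear Y -> B}, forall y, g (k y) = h y.

Definition left_almost_split X B (f : {linear X -> B}) : Prop :=
  ~ split_mono f /\
  forall Y (h : {linear X -> Y}), finitely_generated Y -> ~ split_mono h ->
    exists k : {linear B -> Y}, forall x, k (f x) = h x.

Definition short_exact X B U (f : {linear X -> B}) (g : {linear B -> U}) :
    Prop :=
  [/\ injective f, forall u, exists b, g b = u &
      forall b, g b = 0 <-> exists x, f x = b].

Definition almost_split_sequence X B U
    (f : {linear X -> B}) (g : {linear B -> U}) : Prop :=
  [/\ finitely_generated X, finitely_generated B, finitely_generated U,
      short_exact f g & left_almost_split f /\ right_almost_split g].

(* alpha U n means alpha(U) = n.  The almost split sequence ending in U is
   unique up to isomorphism, with left term isomorphic to DTr U, and the
   number n does not depend on the decomposition (Krull-Schmidt). *)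
Definition alpha U (n : nat) : Prop :=
  exists X B (f : {linear X -> B}) (g : {linear B -> U})
    (W : 'I_n -> set B),
    almost_split_sequence f g /\ indecomposable_decomposition W.

End Modules.

Section Rings.
Variable R : nzRingType.

(* Left ideals are the submodules of the regular left module R^o. *)
Definition jacobson_radical : set R^o :=
  [set x | forall I : set R^o, maximal_submodule I -> I x].

Definition idempotent (e : R) : Prop := e * e = e.

Definition primitive_idempotent (e : R) : Prop :=
  [/\ idempotent e, e != 0 &
    forall f g : R, idempotent f -> idempotent g ->
      f * g = 0 -> g * f = 0 -> e = f + g -> f = 0 \/ g = 0].

(* The W i need not be distinct or nonzero: only Je = \sum_i W i is asked. *)
Definition left_multiserial (m : nat) : Prop :=
  forall e : R, primitive_idempotent e ->
    exists W : 'I_m -> set R^o,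
      (forall i, uniserial_submodule (W i)) /\
      [set (x : R) * e | x in jacobson_radical] = sum_submodules W.

End Rings.

(* Main.v *)
Require Import Defs.
From HB Require Import structures.
From mathcomp Require Import all_boot all_algebra all_field.
From mathcomp Require Import boolp classical_sets generic_quotient ring_quotient.

Set Implicit Arguments.
Unset Strict Implicit.
Unset Printing Implicit Defensive.

Import GRing.Theory.
Local Open Scope ring_scope.

(** Let 0 -> X -> B -> U -> 0 be the almost split sequence, U = A u with e u = u
    for a primitive idempotent e, and let L be the kernel of A e -> U. Since U
    is uniserial, L lies in J e, a sum of m uniserial left ideals V_1, ..., V_m.

    The number n of summands of B is at most the length of the socle of B, hence
    at most length (soc X) + 1, as the socle of U is simple. Now the length of
    soc X is at most that of the top of L (with X = DTr U both are the length of
    the top of the second term of a minimal projective presentation of U). This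
    is obtained without DTr: for each simple module S, a K-linear functional
    that is nonzero on the class of the sequence in Ext(U, X) pairs Hom(S, X) with
    Hom(L, S), and the pairing has no left kernel because the sequence comes
    from an extension of U by S along each nonzero map S -> X
    (dim_killed_le). Intersecting L with the partial sums of the V_i gives a
    filtration by m uniserial factors, so that the top of L has length at most m
    (dim_top_le). Counting simple submodules one isomorphism class at a time
    (card_simple_le) gives n <= m + 1.

    Suppose that n = m + 1. Then each summand of B has a simple socle, since
    otherwise the socle of B would be too long (unique_simple). If U is simple,
    then no simple submodule of B maps onto U and n <= m. Otherwise, as rad U is
    uniserial, some V_j maps onto it, that is, V_j + L = J e. If L is contained
    in V_j, then the bound above holds with 1 in place of m, and n <= 2 <= m.
    If not, choose a maximal submodule L1 of L that contains the intersection of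
    L and V_j. The epimorphism A e / L1 -> U is not split, hence it lifts to B, and
    some component of the lift embeds A e / L1 into an indecomposable summand
    (relations_component). So A e / L1 has a simple socle, which must be
    L / L1; but V_j has a nonzero image in A e / L1 that meets L / L1 trivially. *)

(** * Linear algebra *)

Section LinearAlgebra.
Variable K : fieldType.

Definition subspace (V : vectType K) (S : V -> Prop) : Prop :=
  S 0 /\ forall k x y, S x -> S y -> S (k *: x + y).

Lemma subspace_vspace (V : vectType K) (S : V -> Prop) :
  subspace S -> exists W : {vspace V}, forall x, (x \in W) <-> S x.
Proof.
move=> [S0 SD].
pose P n := `[< exists W : {vspace V}, (forall x, x \in W -> S x) /\ \dim W = n >].
have exP : exists n, P n.
  exists 0%N; apply/asboolP; exists 0%VS; rewrite dimv0; split=> // x.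
  by rewrite memv0 => /eqP->.
have ubP n : P n -> (n <= \dim {:V})%N.
  by move=> /asboolP[W [_ <-]]; apply/dimvS/subvf.
case: (ex_maxnP exP ubP) => n /asboolP[W [WS dW]] maxn.
exists W => x; split; first exact: WS.
move=> Sx; pose W' := (W + <[x]>)%VS.
have W'S y : y \in W' -> S y.
  move=> /memv_addP[w wW [z /vlineP[k ->] ->]]; rewrite addrC.
  by apply: SD => //; apply: WS.
have W'W : (W' <= W)%VS.
  rewrite -(dimv_leqif_sup (addvSl W <[x]>)).
  rewrite eqn_leq dimvS ?addvSl //= dW; apply: maxn.
  by apply/asboolP; exists W'.
by apply: (subvP W'W); apply: (subvP (addvSr W _)); apply: memv_line.
Qed.

(** The default value 0 is only reached when S is not closed under linear
    combinations. *)
Definition vset (V : vectType K) (S : V -> Prop) : {vspace V} :=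
  xget 0%VS [set W : {vspace V} | forall x, (x \in W) <-> S x].

Lemma memv_vset (V : vectType K) (S : V -> Prop) x :
  subspace S -> (x \in vset S) <-> S x.
Proof.
by move=> /subspace_vspace[W WS]; rewrite /vset; case: xgetP => [W' _ ->|/(_ W)].
Qed.

(** A complement of N1 in Z1 embeds into Z2 and meets N2 trivially; F need not
    map N1 into N2. *)
Lemma dim_quotient_inj (V1 V2 : vectType K) (F : 'Hom(V1, V2))
    (Z1 N1 : {vspace V1}) (Z2 N2 : {vspace V2}) :
  (N1 <= Z1)%VS -> (N2 <= Z2)%VS ->
  (forall z, z \in Z1 -> F z \in Z2) ->
  (forall z, z \in Z1 -> F z \in N2 -> z \in N1) ->
  (\dim Z1 - \dim N1 <= \dim Z2 - \dim N2)%N.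
Proof.
move=> N1Z1 N2Z2 FZ FN; pose D := (Z1 :\: N1)%VS.
have dD : (\dim Z1 - \dim N1 = \dim D)%N.
  by rewrite -(dimv_cap_compl Z1 N1) (capv_idPr N1Z1) addKn.
have DZ : (D <= Z1)%VS by exact: diffvSl.
have kerD z : z \in D -> F z \in N2 -> z = 0.
  move=> zD Fz; apply/eqP; rewrite -memv0 -(capv_diff Z1 N1) memv_cap zD.
  by rewrite FN // (subvP DZ).
have -> : (\dim Z1 - \dim N1 = \dim (F @: D))%N.
  rewrite limg_dim_eq //; apply/eqP; rewrite -subv0; apply/subvP => z.
  rewrite memv_cap memv_ker => /andP[zD /eqP Fz].
  by rewrite memv0 (kerD z) // Fz mem0v.
have disj : (F @: D :&: N2 = 0)%VS.
  apply/eqP; rewrite -subv0; apply/subvP => y; rewrite memv_cap.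
  case/andP=> /memv_imgP[z zD ->] Fz; rewrite (kerD z) ?linear0 ?mem0v //.
rewrite -[X in (X <= _)%N](addnK (\dim N2)) leq_sub2r //.
rewrite -dimv_disjoint_sum // dimvS // subv_add N2Z2 andbT.
by apply/subvP => y /memv_imgP[z zD ->]; apply: FZ; apply: (subvP DZ).
Qed.

(** A pairing between H and C, nondegenerate on the side of H and vanishing
    on N, embeds H into the dual of C / N. *)
Lemma dim_nondegenerate_pairing (V W : vectType K) (b : W -> V -> K^o)
    (H : {vspace V}) (C N : {vspace W}) :
  (forall k c c' y, b (k *: c + c') y = k *: b c y + b c' y) ->
  (forall c k y y', b c (k *: y + y') = k *: b c y + b c y') ->
  (N <= C)%VS -> (forall c y, c \in N -> y \in H -> b c y = 0) ->
  (forall y, y \in H -> y != 0 -> exists2 c, c \in C & b c y != 0) ->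
  (\dim H <= \dim C - \dim N)%N.
Proof.
move=> bL bR NC bN bH; pose D := (C :\: N)%VS.
have -> : (\dim C - \dim N = \dim D)%N.
  by rewrite -(dimv_cap_compl C N) (capv_idPr NC) addKn.
pose X := vbasis D.
pose F (y : V) : 'rV[K]_(\dim D) := \row_i b X`_i y.
have Flin : linear F by move=> k x y; apply/rowP => i; rewrite !mxE bR.
pose Fl := GRing.isLinear.Build K V _ _ F Flin.
pose F' : {linear V -> 'rV[K]_(\dim D)} := HB.pack F Fl.
have b0 c c' y : b (c + c') y = b c y + b c' y by rewrite -[c]scale1r bL !scale1r.
have bz y : b 0 y = 0.
  by apply: (addrI (b 0 y)); rewrite -b0 !addr0.
have bZ k c y : b (k *: c) y = k *: b c y by rewrite -[k *: c]addr0 bL bz addr0.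
have HF : (H :&: lker (linfun F') = 0)%VS.
  apply/eqP; rewrite -subv0; apply/subvP => y.
  rewrite memv_cap memv_ker lfunE /= memv0 => /andP[yH /eqP Fy].
  case: (eqVneq y 0) => // ny; case: (bH y yH ny) => c cC /negP[].
  have: c \in (D + N)%VS by rewrite addv_diff (addv_idPl NC).
  case/memv_addP=> d dD [n nN ->]; rewrite b0 (bN n) // addr0.
  rewrite (coord_vbasis dD); apply/eqP.
  have := congr1 (fun f : 'rV[K]_(\dim D) => f 0 _) Fy.
  move: (index_enum _) => r E.
  elim: r => [|i r IH]; first by rewrite big_nil bz.
  by rewrite big_cons b0 IH addr0 bZ; have := E i; rewrite !mxE => ->; rewrite scaler0.
rewrite -(limg_dim_eq HF); apply: (leq_trans (dimvS (subvf _))).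
by rewrite dimvf /dim /= mul1n.
Qed.

Lemma separating_functional (V : vectType K) (N : {vspace V}) (v : V) :
  v \notin N -> exists l : 'Hom(V, K^o), l v != 0 /\ forall x, x \in N -> l x = 0.
Proof.
move=> vN; pose pi := projv (N^C)%VS.
have kerpi : (N <= lker (\1 - projv N)%VF)%VS.
  by apply/subvP => x xN; rewrite memv_ker add_lfunE opp_lfunE id_lfunE projv_id ?subrr.
have nz : (\1 - projv N)%VF v != 0.
  rewrite add_lfunE opp_lfunE id_lfunE subr_eq0; apply: contra vN => /eqP->.
  exact: memv_proj.
set w := (_ v) in nz.
have : coord (vbasis fullv) ^~ w != (fun=> 0).
  apply/eqP => c0; case/negP: nz; rewrite (coord_vbasis (memvf w)) big1 // => i _.
  by rewrite (congr1 (fun f => f i) c0) scale0r.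
move=> /eqP/funeqP/existsNP[i /eqP ci].
exists (linfun (coord (vbasis fullv) i : {linear V -> K^o}) \o (\1 - projv N))%VF.
rewrite comp_lfunE lfunE; split=> // x xN.
by rewrite comp_lfunE; have := subvP kerpi x xN; rewrite memv_ker => /eqP->; rewrite linear0.
Qed.

End LinearAlgebra.

(** * Finite-dimensional modules *)

(** The vector space structure over K is part of the data, so that dimensions
    are available; an action is a plain function, so that the regular module
    acts by multiplication up to conversion. *)
Record fdmod (K : fieldType) (A : falgType K) := Fdmod {
  carrier :> vectType K;
  act : A -> carrier -> carrier;
  act1 : forall v, act 1 v = v;
  actA : forall a b v, act a (act b v) = act (a * b) v;
  act_linl : forall v, linear (fun a : A => act a v);
  act_linr : forall a, linear (act a)
}.

Section Modules.
Variables (K : fieldType) (A : falgType K).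
Implicit Types M N : fdmod A.

Definition evfun M (v : M) (a : A) : M := act a v.
HB.instance Definition _ M v :=
  GRing.isLinear.Build K A M *:%R (@evfun M v) (@act_linl K A M v).
HB.instance Definition _ M a :=
  GRing.isLinear.Build K M M *:%R (@act K A M a) (@act_linr K A M a).

Definition ev M (v : M) : 'Hom(A, M) := linfun (evfun v).
Definition lact M (a : A) : 'End(M) := linfun (@act K A M a).

Lemma evE M (v : M) a : ev v a = act a v. Proof. exact: lfunE. Qed.
Lemma lactE M a (v : M) : lact M a v = act a v. Proof. exact: lfunE. Qed.

Section Action.
Variable M : fdmod A.
Implicit Types (a b : A) (u v : M).

Lemma actDl a b v : act (a + b) v = act a v + act b v.
Proof. by rewrite -!evE linearD. Qed.
Lemma actBl a b v : act (a - b) v = act a v - act b v.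
Proof. by rewrite -!evE linearB. Qed.
Lemma actZl k a v : act (k *: a) v = k *: act a v.
Proof. by rewrite -!evE linearZ. Qed.
Lemma actDr a u v : act a (u + v) = act a u + act a v.
Proof. exact: linearD. Qed.
Lemma actBr a u v : act a (u - v) = act a u - act a v.
Proof. exact: linearB. Qed.
Lemma actZr k a v : act a (k *: v) = k *: act a v.
Proof. exact: linearZ. Qed.
Lemma act0r a : act a (0 : M) = 0. Proof. exact: linear0. Qed.
Lemma act_sumr I (r : seq I) (P : pred I) (F : I -> M) a :
  act a (\sum_(i <- r | P i) F i) = \sum_(i <- r | P i) act a (F i).
Proof. exact: linear_sum. Qed.

End Action.

Definition stable M (W : {vspace M}) : Prop :=
  forall a v, v \in W -> act a v \in W.

Definition equivariant M N (g : 'Hom(M, N)) : Prop :=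
  forall a v, g (act a v) = act a (g v).

Definition cyc M (v : M) : {vspace M} := limg (ev v).
Definition ann M (v : M) : {vspace A} := lker (ev v).

Lemma memv_cyc M (v w : M) : w \in cyc v <-> exists a, w = act a v.
Proof.
split=> [/memv_imgP[a _ ->]|[a ->]]; first by exists a; rewrite evE.
by rewrite -evE memv_img ?memvf.
Qed.

Lemma cyc_id M (v : M) : v \in cyc v.
Proof. by apply/memv_cyc; exists 1; rewrite act1. Qed.

Lemma memv_ann M (v : M) a : (a \in ann v) = (act a v == 0).
Proof. by rewrite memv_ker evE. Qed.

Lemma stable_cyc M (v : M) : stable (cyc v).
Proof. by move=> a w /memv_cyc[b ->]; apply/memv_cyc; exists (a * b); rewrite actA. Qed.

Lemma cyc_sub M (W : {vspace M}) v : stable W -> v \in W -> (cyc v <= W)%VS.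
Proof. by move=> sW vW; apply/subvP => w /memv_cyc[a ->]; apply: sW. Qed.

Lemma stable0 M : stable (0%VS : {vspace M}).
Proof. by move=> a v; rewrite !memv0 => /eqP->; rewrite act0r. Qed.

Lemma stablef M : stable (fullv : {vspace M}).
Proof. by move=> a v _; apply: memvf. Qed.

Lemma stable_cap M (W1 W2 : {vspace M}) :
  stable W1 -> stable W2 -> stable (W1 :&: W2)%VS.
Proof. by move=> s1 s2 a v; rewrite !memv_cap => /andP[v1 v2]; rewrite s1 ?s2. Qed.

Lemma stable_add M (W1 W2 : {vspace M}) :
  stable W1 -> stable W2 -> stable (W1 + W2)%VS.
Proof.
by move=> s1 s2 a v /memv_addP[x x1 [y y2 ->]]; rewrite actDr memv_add ?s1 ?s2.
Qed.

Lemma stable_sum M (I : finType) (P : pred I) (W : I -> {vspace M}) :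
  (forall i, stable (W i)) -> stable (\sum_(i | P i) W i)%VS.
Proof.
move=> sW; elim/big_rec: _ => [|i x _ sx]; first exact: stable0.
exact: stable_add.
Qed.

Lemma stable_img M N (g : 'Hom(M, N)) W :
  equivariant g -> stable W -> stable (g @: W)%VS.
Proof. by move=> eg sW a w /memv_imgP[v vW ->]; rewrite -eg memv_img ?sW. Qed.

Lemma stable_preim M N (g : 'Hom(M, N)) W :
  equivariant g -> stable W -> stable (g @^-1: W)%VS.
Proof. by move=> eg sW a w; rewrite -!memv_preim eg; apply: sW. Qed.

Lemma stable_lker M N (g : 'Hom(M, N)) : equivariant g -> stable (lker g).
Proof. by move=> eg a w; rewrite !memv_ker eg => /eqP->; rewrite act0r. Qed.

Definition regmod : fdmod A.
Proof.
exists A (fun a b => a * b) => [v|a b v|v k a b|a k b v].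
- exact: mul1r.
- exact: mulrA.
- by rewrite mulrDl scalerAl.
- by rewrite mulrDr scalerAr.
Defined.

Lemma ev_equivariant M (v : M) :
  @equivariant regmod M (ev v).
Proof. by move=> a b; rewrite !evE /= actA. Qed.

Lemma stable_ann M (v : M) : @stable regmod (ann v).
Proof. exact: stable_lker (@ev_equivariant M v). Qed.

(** Elementwise forms of simplicity of T and maximality of I; they are the
    ones that provide scalars. *)
Definition simple M (T : {vspace M}) : Prop :=
  [/\ stable T, T != 0%VS & forall t, t \in T -> t != 0 -> (T <= cyc t)%VS].

Definition maxideal (I : {vspace A}) : Prop :=
  [/\ @stable regmod I, 1 \notin I &
      forall c, c \notin I -> exists x, x * c - 1 \in I].

Lemma min_dim M (P : {vspace M} -> Prop) W :
  P W -> exists2 T, P T & forall Q, P Q -> (\dim T <= \dim Q)%N.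
Proof.
move=> PW; pose p n := `[< exists2 T : {vspace M}, P T & \dim T = n >].
have exp : exists n, p n by exists (\dim W); apply/asboolP; exists W.
case: (ex_minnP exp) => n /asboolP[T PT <-] minn.
by exists T => // Q PQ; apply: minn; apply/asboolP; exists Q.
Qed.

Lemma max_dim M (P : {vspace M} -> Prop) W :
  P W -> exists2 T, P T & forall Q, P Q -> (\dim Q <= \dim T)%N.
Proof.
move=> PW; pose p n := `[< exists2 T : {vspace M}, P T & \dim T = n >].
have exp : exists n, p n by exists (\dim W); apply/asboolP; exists W.
have ubp n : p n -> (n <= \dim {:M})%N.
  by move=> /asboolP[T _ <-]; apply/dimvS/subvf.
case: (ex_maxnP exp ubp) => n /asboolP[T PT <-] maxn.
by exists T => // Q PQ; apply: maxn; apply/asboolP; exists Q.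
Qed.

Lemma simple_exists M (W : {vspace M}) :
  stable W -> W != 0%VS -> exists2 T, simple T & (T <= W)%VS.
Proof.
move=> sW nW.
have [T [sT nT TW] minT] := @min_dim M
  (fun T => [/\ stable T, T != 0%VS & (T <= W)%VS]) W (And3 sW nW (subvv W)).
exists T => //; split=> // t tT nt; have tTs := cyc_sub sT tT.
rewrite -(dimv_leqif_sup tTs) eqn_leq dimvS //=; apply: minT; split.
- exact: stable_cyc.
- by apply: contraNneq nt => c0; rewrite -memv0 -c0 cyc_id.
- exact: subv_trans TW.
Qed.

Lemma simple_sub M (T P : {vspace M}) :
  simple T -> stable P -> (P <= T)%VS -> P != 0%VS -> P = T.
Proof.
move=> [_ _ sT] sP PT nP; apply/eqP; rewrite eqEsubv PT /=.
have pP := memv_pick P; apply: subv_trans (cyc_sub sP pP).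
by apply: sT; rewrite ?(subvP PT) // vpick0.
Qed.

Lemma simple_img M N (g : 'Hom(M, N)) T :
  equivariant g -> simple T -> (g @: T)%VS != 0%VS -> simple (g @: T)%VS.
Proof.
move=> eg [sT _ cT] nT; split=> //; first exact: stable_img.
move=> y /memv_imgP[t tT ->] nt; apply/subvP => z /memv_imgP[s sT' ->].
have nt' : t != 0 by apply: contraNneq nt => ->; rewrite linear0.
case/memv_cyc: (subvP (cT t tT nt') s sT') => a ->.
by apply/memv_cyc; exists a; rewrite eg.
Qed.

Lemma ann_maxideal M (T : {vspace M}) t :
  simple T -> t \in T -> t != 0 -> maxideal (ann t).
Proof.
move=> [sT _ cT] tT nt; split; first exact: stable_ann.
  by rewrite memv_ann act1.
move=> c; rewrite memv_ann => nc.
have /memv_cyc[x xE] := subvP (cT _ (sT c t tT) nc) t tT.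
by exists x; rewrite memv_ann actBl act1 -actA -xE subrr.
Qed.

Lemma maxideal_eq (I I' : {vspace A}) :
  maxideal I -> @stable regmod I' -> (I <= I')%VS -> 1 \notin I' -> I' = I.
Proof.
move=> [_ _ mI] sI' II' n1; apply/eqP; rewrite eqEsubv II' andbT.
apply/subvP => c cI'; apply/negPn/negP => /mI[x xI]; case/negP: n1.
have -> : 1 = x * c - (x * c - 1) by rewrite opprB addrC subrK.
by rewrite memvB ?(subvP II' _ xI) //; apply: (sI' x).
Qed.

(** * Homomorphisms between simple modules *)

(** For left ideals I and I', the elements of A that give by right
    multiplication a homomorphism from A / I to A / I'. *)
Definition conductor (I I' : {vspace A}) : {vspace A} :=
  vset (fun c => forall a, a \in I -> a * c \in I').

Lemma memv_conductor I I' c :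
  c \in conductor I I' <-> forall a, a \in I -> a * c \in I'.
Proof.
apply: memv_vset; split=> [a _|k x y Ix Iy a aI]; first by rewrite mulr0 mem0v.
by rewrite mulrDr -scalerAr memvD ?memvZ ?Ix ?Iy.
Qed.

(** The dimension of the space of homomorphisms from A / I to A / I'. *)
Definition dim_hom (I I' : {vspace A}) : nat :=
  (\dim (conductor I I') - \dim I')%N.

(** For maximal I and I', this says that A / I and A / I' are isomorphic. *)
Definition linked (I I' : {vspace A}) : Prop :=
  exists2 c, c \in conductor I I' & c \notin I'.

Lemma sub_conductor I I' : @stable regmod I' -> (I' <= conductor I I')%VS.
Proof. by move=> sI; apply/subvP => c cI; apply/memv_conductor => a _; apply: (sI a). Qed.

Lemma conductorM I1 I2 I3 x y :
  x \in conductor I1 I2 -> y \in conductor I2 I3 -> x * y \in conductor I1 I3.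
Proof.
move=> /memv_conductor x12 /memv_conductor y23; apply/memv_conductor => a aI.
by rewrite mulrA y23 ?x12.
Qed.

Lemma linked_refl I : maxideal I -> linked I I.
Proof.
by move=> [_ n1 _]; exists 1 => //; apply/memv_conductor => a; rewrite mulr1.
Qed.

(** The map A / I -> A / I' given by c is not zero, hence injective. *)
Lemma linked_preim I I' c z : maxideal I -> @stable regmod I' ->
  c \in conductor I I' -> c \notin I' -> z * c \in I' -> z \in I.
Proof.
move=> mI sI' /memv_conductor cI nc zc.
rewrite -(@maxideal_eq I (@ev regmod c @^-1: I')%VS) //.
- by rewrite -memv_preim evE.
- exact: (stable_preim (@ev_equivariant regmod c)).
- by apply/subvP => a aI; rewrite -memv_preim evE cI.
- by rewrite -memv_preim evE /= mul1r.
Qed.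

Lemma linked_sym I I' : maxideal I -> maxideal I' -> linked I I' -> linked I' I.
Proof.
move=> mI [sI' n1 mI'] [c cI nc]; have [x xI] := mI' c nc.
have xc1 : x * c = (x * c - 1) + 1 by rewrite subrK.
exists x; first apply/memv_conductor => a aI.
  apply: (linked_preim mI sI' cI nc); rewrite -mulrA xc1 mulrDr mulr1 memvD //.
  exact: (sI' a).
apply: contra n1 => xI0; rewrite -(subKr (x * c) 1) memvB //.
by move/memv_conductor: cI; apply.
Qed.

Lemma linked_trans I1 I2 I3 : maxideal I1 -> maxideal I2 -> @stable regmod I3 ->
  linked I1 I2 -> linked I2 I3 -> linked I1 I3.
Proof.
move=> mI1 mI2 sI3 [c c12 nc] [d d23 nd]; exists (c * d).
  exact: conductorM c12 d23.
by apply: contra nc; apply: linked_preim.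
Qed.

Lemma dim_hom0 I I' : ~ linked I I' -> dim_hom I I' = 0%N.
Proof.
move=> nl; apply/eqP; rewrite subn_eq0 dimvS //; apply/subvP => c cI.
by apply/negPn/negP => nc; apply: nl; exists c.
Qed.

Lemma dim_hom_gt0 I : maxideal I -> (0 < dim_hom I I)%N.
Proof.
move=> [sI n1 _]; rewrite subn_gt0 ltn_neqAle dimvS ?sub_conductor // andbT.
rewrite (dimv_leqif_sup (sub_conductor _ sI)); apply: contra n1 => /subvP; apply.
by apply/memv_conductor => a; rewrite mulr1.
Qed.

(** Composing with a nonzero map between simple modules is injective. *)
Lemma dim_homr I I1 I2 : maxideal I1 -> @stable regmod I2 ->
  linked I1 I2 -> (dim_hom I I1 <= dim_hom I I2)%N.
Proof.
move=> mI1 sI2 [x x12 nx]; have [sI1 _ _] := mI1.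
apply: (@dim_quotient_inj _ _ _ (@ev regmod x)); rewrite ?sub_conductor //.
- by move=> z zI; rewrite evE; apply: conductorM x12.
- by move=> z _; rewrite evE; apply: linked_preim.
Qed.

Lemma dim_homl I I1 I2 : maxideal I1 -> @stable regmod I2 ->
  linked I I1 -> (dim_hom I1 I2 <= dim_hom I I2)%N.
Proof.
move=> [sI1 n1 mI1] sI2 [x x1 nx]; have [y yx] := mI1 x nx.
apply: (@dim_quotient_inj _ _ _ (lact regmod x)); rewrite ?sub_conductor //.
- by move=> z zI; rewrite lactE; apply: conductorM zI.
- move=> z /memv_conductor zI; rewrite lactE => xz.
  have -> : z = y * (x * z) - (y * x - 1) * z.
    by rewrite mulrA -mulrBl opprB addrC subrK mul1r.
  by rewrite memvB ?zI //; apply: (sI2 y).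
Qed.

(** This is Hom(A / I, W), a homomorphism being given by the image of 1. *)
Definition killed M (I : {vspace A}) (W : {vspace M}) : {vspace M} :=
  vset (fun y => y \in W /\ forall a, a \in I -> act a y = 0).

Lemma memv_killed M I (W : {vspace M}) y :
  y \in killed I W <-> y \in W /\ forall a, a \in I -> act a y = 0.
Proof.
apply: memv_vset; split=> [|k u v [uW uI] [vW vI]].
  by rewrite mem0v; split=> // a _; rewrite act0r.
rewrite memvD ?memvZ //; split=> // a aI.
by rewrite actDr actZr uI // vI // scaler0 addr0.
Qed.

Lemma killedS M I (W1 W2 : {vspace M}) :
  (W1 <= W2)%VS -> (killed I W1 <= killed I W2)%VS.
Proof.
move=> W12; apply/subvP => y /memv_killed[yW yI]; apply/memv_killed.
by rewrite (subvP W12).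
Qed.

Lemma dim_killed_cyc M I (t : M) : \dim (killed I (cyc t)) = dim_hom I (ann t).
Proof.
have st := @stable_ann M t.
have -> : killed I (cyc t) = (ev t @: conductor I (ann t))%VS.
  apply/vspaceP => y; apply/idP/idP.
    case/memv_killed => /memv_cyc[c ->] yI; rewrite -evE memv_img //.
    by apply/memv_conductor => a aI; rewrite memv_ann -actA yI.
  case/memv_imgP => c /memv_conductor cI ->; rewrite evE; apply/memv_killed.
  split; first by apply/memv_cyc; exists c.
  by move=> a /cI; rewrite memv_ann -actA => /eqP.
rewrite /dim_hom -(limg_ker_dim (ev t) (conductor I (ann t))).
by rewrite (capv_idPr _) ?addKn // sub_conductor.
Qed.

End Modules.

(** * The socle of the left end of the sequence *)

Section Socle.
Variables (K : fieldType) (A : falgType K).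
Implicit Types (M : fdmod A) (I L P : {vspace A}).

(** This encodes Hom(L / P, A / I) inside the linear endomorphisms of A, up to
    the subspace lifts L L I of the maps that induce zero. *)
Definition lifts L P I : {vspace 'End(A)} :=
  vset (fun phi : 'End(A) =>
    (forall a l, l \in L -> phi (a * l) - a * phi l \in I) /\
    (forall l, l \in P -> phi l \in I)).

Lemma memv_lifts L P I (phi : 'End(A)) :
  phi \in lifts L P I <->
    (forall a l, l \in L -> phi (a * l) - a * phi l \in I) /\
    (forall l, l \in P -> phi l \in I).
Proof.
apply: memv_vset; split=> [|k f g [fL fP] [gL gP]].
  by split=> [a l _|l _]; rewrite !zero_lfunE ?mulr0 ?subr0 mem0v.
split=> [a l lL|l lP]; last first.
  by rewrite add_lfunE scale_lfunE memvD ?memvZ ?fP ?gP.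
rewrite !add_lfunE !scale_lfunE mulrDr -scalerAr opprD addrACA -scalerBr.
by rewrite memvD ?memvZ ?fL ?gL.
Qed.

Lemma liftsS L P P' I : (P <= P')%VS -> (lifts L P' I <= lifts L P I)%VS.
Proof.
move=> PP; apply/subvP => f /memv_lifts[fL fP]; apply/memv_lifts; split=> // l lP.
by rewrite fP ?(subvP PP).
Qed.

Definition apply_to (l : A) (phi : 'End(A)) : A := phi l.

Lemma apply_to_linear l : linear (apply_to l).
Proof. by move=> k f g; rewrite /apply_to add_lfunE scale_lfunE. Qed.

HB.instance Definition _ l :=
  GRing.isLinear.Build K 'End(A) A *:%R (apply_to l) (apply_to_linear l).

Lemma ev_lin M k (x y : M) : ev (k *: x + y) = k *: ev x + ev y.
Proof.
by apply/lfunP => a; rewrite add_lfunE scale_lfunE !evE actDr actZr.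
Qed.

(** The Auslander-Reiten formula in the form needed here.  Think of X as the
    kernel of B -> U = A u and of p0 as a preimage of u, so that
    l |-> l p0 is a homomorphism from L to X that represents the extension in
    Hom(L, X) modulo the multiplications by elements of X; the hypotheses say
    that it is not zero, but that it becomes zero in every proper quotient
    of X.  A linear functional that is nonzero on this class pairs
    Hom(S, X) with Hom(L, S) for each simple module S = A / I, without left
    kernel: for 0 != h : S -> X the class comes from L -> S along h. *)
Lemma dim_killed_le M (X : {vspace M}) (p0 : M) L I :
  @stable _ _ (regmod A) L -> maxideal I -> stable X ->
  (forall x, x \in X -> ~ forall l, l \in L -> act l (p0 - x) = 0) ->
  (forall Y : {vspace M}, stable Y -> (Y <= X)%VS -> Y != 0%VS ->
    exists2 x, x \in X & forall l, l \in L -> act l (p0 - x) \in Y) ->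
  (\dim (killed I X) <= \dim (lifts L 0 I) - \dim (lifts L L I))%N.
Proof.
move=> sL mI sX nsplit ex; pose rho := projv L.
have rhoL l : l \in L -> rho l = l by exact: projv_id.
pose N := vset (fun f : 'Hom(A, M) => exists2 x, x \in X & f = (ev x \o rho)%VF).
have memN f : f \in N <-> exists2 x, x \in X & f = (ev x \o rho)%VF.
  apply: memv_vset; split=> [|k f1 f2 [x1 x1X ->] [x2 x2X ->]].
    exists 0; first exact: mem0v.
    by apply/lfunP => a; rewrite zero_lfunE comp_lfunE evE act0r.
  exists (k *: x1 + x2); first by rewrite memvD ?memvZ.
  by rewrite ev_lin comp_lfunDl comp_lfunZl.
have vN : (ev p0 \o rho)%VF \notin N.
  apply/negP => /memN[x xX E]; apply: (nsplit x xX) => l lL.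
  have := congr1 (fun f : 'Hom(A, M) => f l) E.
  by rewrite !comp_lfunE rhoL // !evE actBr => ->; rewrite subrr.
have [lam [lamv lamN]] := separating_functional vN.
pose b (phi : 'End(A)) (y : M) := lam (ev y \o phi \o rho)%VF.
apply: (@dim_nondegenerate_pairing _ _ _ b).
- move=> k f f' y; rewrite /b -linearP; congr (lam _).
  by rewrite comp_lfunDr comp_lfunDl -comp_lfunZr -comp_lfunZl.
- move=> f k y y'; rewrite /b -linearP; congr (lam _).
  by rewrite ev_lin !comp_lfunDl -!comp_lfunZl.
- exact: liftsS (sub0v _).
- move=> f y /memv_lifts[_ fL] /memv_killed[_ yI].
  rewrite /b (_ : (_ \o _)%VF = 0) ?linear0 //; apply/lfunP => a.
  by rewrite zero_lfunE !comp_lfunE evE yI // fL // memv_proj.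
move=> y /memv_killed[yX yI] ny.
have [x xX xY] : exists2 x, x \in X & forall l, l \in L -> act l (p0 - x) \in cyc y.
  apply: ex; [exact: stable_cyc|exact: cyc_sub|].
  by apply: contraNneq ny => c0; rewrite -memv0 -c0 cyc_id.
pose phi : 'End(A) := ((ev y)^-1 \o ev (p0 - x) \o rho)%VF.
have phiE l : l \in L -> act (phi l) y = act l (p0 - x).
  by move=> lL; rewrite -evE !comp_lfunE rhoL // limg_lfunVK evE // xY.
have annI : ann y = I.
  apply: maxideal_eq; rewrite ?memv_ann ?act1 //; first exact: stable_ann.
  by apply/subvP => a /yI ay; rewrite memv_ann ay.
have phi0 : phi 0 = 0 by rewrite linear0.
exists phi; move: phi phiE phi0 => phi phiE phi0.
  apply/memv_lifts; split=> [a l lL|l]; last first.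
    by rewrite memv0 => /eqP->; rewrite phi0 mem0v.
  rewrite -annI memv_ann actBl -actA !phiE ?actA ?subrr //; exact: (sL a).
rewrite /b (_ : (_ \o _)%VF = (ev p0 \o rho)%VF - (ev x \o rho)%VF).
  by rewrite [lam _]linearB /= (lamN (ev x \o rho)%VF) ?subr0 //; apply/memN; exists x.
apply/lfunP => a; rewrite add_lfunE opp_lfunE !comp_lfunE !evE.
by rewrite -actBr phiE ?memv_proj.
Qed.

(** * The top of a submodule of a sum of uniserial modules *)

(** This is uniseriality of the subquotient Q / P. *)
Definition serial M (P Q : {vspace M}) : Prop :=
  forall W W', stable W -> stable W' -> (P <= W <= Q)%VS -> (P <= W' <= Q)%VS ->
    (W <= W')%VS \/ (W' <= W)%VS.

(** The terms of a filtration of L with serial factors each contribute at most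
    one simple module to the top of L, the simple quotient of the factor. *)
Lemma serial_layer P Q L :
  @stable _ _ (regmod A) P -> @stable _ _ (regmod A) Q ->
  (P <= Q)%VS -> (Q <= L)%VS -> @serial (regmod A) P Q ->
  exists I', (maxideal I' \/ I' = fullv) /\
    forall I, maxideal I ->
      (\dim (lifts L P I) - \dim (lifts L Q I) <= dim_hom I' I)%N.
Proof.
move=> sP sQ PQ QL ser; case: (eqVneq P Q) => [->|nPQ].
  by exists fullv; split=> [|I _]; [right | rewrite subnn].
pose ok R := [/\ @stable _ _ (regmod A) R, (P <= R)%VS, (R <= Q)%VS & R != Q].
have [R [sR PR RQ nRQ] maxR] := @max_dim _ _ (regmod A) ok P (And4 sP (subvv P) PQ nPQ).
have RP R' : ok R' -> (R' <= R)%VS.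
  move=> okR'; have [sR' PR' RQ' _] := okR'.
  have [] // := ser R R' sR sR'; rewrite ?PR ?RQ ?PR' //.
  move=> RR; rewrite (_ : R' = R) ?subvv //; apply/eqP.
  by rewrite eq_sym eqEdim RR maxR.
have /subvPn[l lQ lR] : ~~ (Q <= R)%VS.
  by apply: contra nRQ => QR; rewrite eqEsubv RQ QR.
pose I' := (@ev _ _ (regmod A) l @^-1: R)%VS.
have memI' a : (a \in I') = (a * l \in R) by rewrite -memv_preim evE.
have sI' : @stable _ _ (regmod A) I'.
  exact: (stable_preim (@ev_equivariant _ _ (regmod A) l)).
(* R is the largest proper term, so anything outside R generates Q over P *)
have genQ r x : r \in Q -> r \notin R -> x \in Q -> exists a, x - a * r \in P.
  move=> rQ rR xQ; pose R' := (@cyc _ _ (regmod A) r + P)%VS.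
  have sR' : @stable _ _ (regmod A) R' by apply: stable_add => //; apply: stable_cyc.
  have rR' : r \in R' by rewrite -[r]addr0 memv_add ?mem0v ?(@cyc_id _ _ (regmod A)).
  have R'Q : (R' <= Q)%VS by rewrite subv_add PQ (@cyc_sub _ _ (regmod A)).
  have R'E : R' = Q.
    apply/eqP/negPn/negP => nR'; case/negP: rR; apply: (subvP (RP R' _)) => //.
    by split=> //; apply: addvSr.
  move: xQ; rewrite -R'E => /memv_addP[y /memv_cyc[a ->] [z zP ->]].
  by exists a; rewrite addrC addKr.
exists I'; split.
  left; split=> //; first by rewrite memI' mul1r.
  move=> c; rewrite memI' => cl.
  have [a aP] := genQ (c * l) l (sQ c l lQ) cl lQ.
  exists a; rewrite memI' -memvN -mulNr opprB mulrBl mul1r -mulrA.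
  exact: (subvP PR).
move=> I mI; have [sI n1 mI1] := mI.
have fQ (f : 'End(A)) r : f \in lifts L P I -> r \in Q -> r \notin R -> f r \in I ->
    forall x, x \in Q -> f x \in I.
  move=> /memv_lifts[fL fP] rQ rR fr x xQ; have [a aP] := genQ r x rQ rR xQ.
  have -> : x = (x - a * r) + a * r by rewrite subrK.
  rewrite linearD /= memvD //; first exact: fP.
  rewrite -[f _](subrK (a * f r)) memvD //; last exact: (sI a).
  by rewrite fL // (subvP QL).
have fR (f : 'End(A)) r : f \in lifts L P I -> r \in R -> f r \in I.
  move=> fI rR; apply/negPn/negP => nr; have [x xI] := mI1 _ nr.
  have [fL fP] := proj1 (memv_lifts _ _ _ _) fI.
  have rQ := subvP RQ r rR; have rL := subvP QL r rQ.
  case/negP: nr; pose a := f l * x.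
  have arR : a * r \in R by apply: (sR a).
  apply: (fQ f (l - a * r)) => //.
  - by rewrite memvB // (subvP RQ).
  - by apply: contra lR => lar; rewrite -[l](subrK (a * r)) memvD.
  rewrite linearB /= -[f (a * r)](subrK (a * f r)) opprD addrCA memvD //.
    by rewrite memvN fL.
  have -> : f l - a * f r = - (f l * (x * f r - 1)).
    by rewrite mulrBr mulr1 opprB mulrA.
  by rewrite memvN; apply: (sI (f l)).
apply: (@dim_quotient_inj _ _ _ (linfun (apply_to l))).
- exact: liftsS.
- exact: sub_conductor.
- move=> f fI; rewrite lfunE /= /apply_to; apply/memv_conductor => a.
  rewrite memI' => al; have [fL fP] := proj1 (memv_lifts _ _ _ _) fI.
  rewrite -[a * f l](subKr (f (a * l))) memvB //; first exact: fR.
  by rewrite fL // (subvP QL).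
- move=> f fI; rewrite lfunE /= /apply_to => fl; apply/memv_lifts.
  have [fL fP] := proj1 (memv_lifts _ _ _ _) fI.
  by split=> //; apply: (fQ f l).
Qed.

(** Intersecting the partial sums of the serial ideals V with L gives a
    filtration whose factors are again serial. *)
Lemma dim_top_le n (V : 'I_n -> {vspace A}) L :
  (forall i, @stable _ _ (regmod A) (V i)) ->
  (forall i, @serial (regmod A) 0 (V i)) ->
  @stable _ _ (regmod A) L -> (L <= \sum_i V i)%VS ->
  exists Q : 'I_n -> {vspace A},
    (forall j, maxideal (Q j) \/ Q j = fullv) /\
    forall I, maxideal I ->
      (\dim (lifts L 0 I) - \dim (lifts L L I) <= \sum_j dim_hom (Q j) I)%N.
Proof.
move=> sV serV sL LV.
pose S (k : nat) := (\sum_(i < n | (i < k)%N) V i)%VS.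
pose F k := (L :&: S k)%VS.
have sS k : @stable _ _ (regmod A) (S k) by exact: stable_sum.
have sF k : @stable _ _ (regmod A) (F k) by exact: stable_cap.
have SS (j : 'I_n) : (S j.+1 = V j + S j)%VS.
  rewrite /S (bigD1 j) ?ltnSn //=; congr (_ + _)%VS; apply: eq_bigl => i.
  by rewrite ltnS andbC (ltn_neqAle i j).
have layer (j : 'I_n) : exists I', (maxideal I' \/ I' = fullv) /\
    forall I, maxideal I ->
      (\dim (lifts L (F j) I) - \dim (lifts L (F j.+1) I) <= dim_hom I' I)%N.
  apply: serial_layer => //; rewrite ?capvSl ?capvS ?SS ?addvSr //.
  (* W is recovered from W + S j, which is V j :&: (W + S j) plus S j *)
  have mod1 (W W' : {vspace A}) : (F j <= W)%VS -> (W <= F j.+1)%VS ->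
      (F j <= W')%VS -> (W' <= F j.+1)%VS ->
      (V j :&: (W + S j) <= V j :&: (W' + S j))%VS -> (W <= W')%VS.
    move=> FW WF FW' W'F le.
    have WL : (W <= L)%VS := subv_trans WF (capvSl _ _).
    have W'L : (W' <= L)%VS := subv_trans W'F (capvSl _ _).
    have WS : (W <= W' + S j)%VS.
      apply: (@subv_trans _ _ (W + S j)%VS); first exact: addvSl.
      have -> : (W + S j = (W + S j) :&: (V j + S j))%VS.
        apply/esym/capv_idPl; rewrite subv_add addvSr andbT -SS.
        exact: subv_trans WF (capvSr _ _).
      rewrite -vspace_modr ?addvSr // subv_add addvSr andbT capvC.
      exact: subv_trans le (capvSr _ _).
    have : (W <= L :&: (W' + S j))%VS by rewrite subv_cap WL.
    by rewrite capvC -vspace_modl // [(S j :&: L)%VS]capvC (addv_idPl FW').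
  move=> W W' sW sW' /andP[FW WF] /andP[FW' W'F].
  have sVj Z : @stable _ _ (regmod A) Z -> @stable _ _ (regmod A) (V j :&: (Z + S j))%VS.
    by move=> sZ; apply: stable_cap => //; apply: stable_add.
  have [] := serV j _ _ (sVj W sW) (sVj W' sW'); rewrite ?sub0v ?capvSl //.
    by move=> le; left; apply: mod1.
  by move=> le; right; apply: mod1.
have /choice[Q QP] := layer; exists Q; split=> [j|I mI]; first by have [] := QP j.
have F0 : F 0%N = 0%VS by rewrite /F /S big_pred0 ?capv0.
have Fn : F n = L.
  by rewrite /F /S (eq_bigl predT) ?(capv_idPl LV) // => i; rewrite ltn_ord.
rewrite -{1}F0 -[X in (_ - \dim (lifts L X I))%N]Fn.
have leq_sub_trans (y x z : nat) : (x - z <= (x - y) + (y - z))%N.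
  rewrite leq_subLR addnCA -maxnE.
  apply: leq_trans (leq_add (leqnn _) (leq_maxr _ _)).
  by rewrite addnC -leq_subLR.
have tele k : (k <= n)%N -> (\dim (lifts L (F 0%N) I) - \dim (lifts L (F k) I)
    <= \sum_(j < n | (j < k)%N) dim_hom (Q j) I)%N.
  elim: k => [|k IH] lek; first by rewrite subnn.
  rewrite (bigD1 (Ordinal lek)) //= addnC.
  apply: (@leq_trans (_ + _)%N); last apply: leq_add.
  - apply: (leq_sub_trans (\dim (lifts L (F k) I))).
  - apply: leq_trans (IH (ltnW lek)) _; apply/eq_leq/eq_bigl => i.
    by rewrite -val_eqE /= ltnS andbC ltn_neqAle.
  - by have [_ ->] := QP (Ordinal lek).
apply: leq_trans (tele n (leqnn n)) _.
by apply/eq_leq/eq_bigl => i; rewrite ltn_ord.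
Qed.

End Socle.

(** * Counting simple submodules *)

(** Each element of J is charged to the only class of E that it is related
    to. *)
Lemma card_le_by_class (I J : finType) (E : rel I) (F : J -> pred I) :
  reflexive E -> symmetric E -> transitive E ->
  (forall j a b, F j a -> F j b -> E a b) ->
  (forall a, #|E a| <= #|[pred j | F j a]|)%N ->
  (#|I| <= #|J|)%N.
Proof.
move=> Er Es Et FE EF; pose rep a := odflt a [pick b | E a b].
have repE a : E a (rep a) by rewrite /rep; case: pickP => //=.
have repP a b : E a b -> rep a = rep b.
  move=> Eab; rewrite /rep; have Eq c : E a c = E b c.
    by apply/idP/idP; apply: Et; rewrite // Es.
  by rewrite (eq_pick Eq); case: pickP => //= /(_ b); rewrite Er.
rewrite -sum1_card (partition_big rep (fun b => rep b == b)) /=; last first.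
  by move=> i _; apply/eqP/esym/repP/repE.
apply: (@leq_trans (\sum_(b | rep b == b) \sum_j F j b)).
  apply: leq_sum => b /eqP repb; rewrite sum1_card.
  apply: (@leq_trans #|E b|).
    apply/subset_leq_card/fintype.subsetP => i; rewrite !unfold_in => /eqP <-.
    by rewrite Es repE.
  by rewrite (leq_trans (EF b)) // -sum1_card big_mkcond.
rewrite exchange_big /= -sum1_card; apply: leq_sum => j _.
case: (pickP (fun b => (rep b == b) && F j b)) => [b /andP[/eqP rb Fb]|no].
  rewrite (bigD1 b) ?rb //= Fb big1 // => c /andP[/eqP rc ncb].
  case Fc: (F j c) => //; case/negP: ncb.
  by rewrite -rc -rb; apply/eqP/repP/(FE j).
rewrite big1 // => b rb; case Fb: (F j b) => //.
by have := no b; rewrite rb Fb.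
Qed.

Section Counting.
Variables (K : fieldType) (A : falgType K).
Implicit Types (M : fdmod A) (I L : {vspace A}).

Definition independent M (J : finType) (T : J -> {vspace M}) : Prop :=
  forall t : J -> M, (forall j, t j \in T j) -> \sum_j t j = 0 -> forall j, t j = 0.

(** Both sides are counted one isomorphism class of simple modules at a time:
    each T j isomorphic to A / I contributes dim End (A / I) to the left hand
    side of the inequality, and each A / Q i at most as much to the right. *)
Lemma card_simple_le M (J J' : finType) (T : J -> {vspace M})
    (Q : J' -> {vspace A}) :
  (forall j, simple (T j)) -> independent T ->
  (forall i, maxideal (Q i) \/ Q i = fullv) ->
  (forall I, maxideal I ->
    (\dim (killed I (\sum_j T j)%VS) <= \sum_i dim_hom (Q i) I)%N) ->
  (#|J| <= #|J'|)%N.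
Proof.
move=> sT iT mQ dQ; pose t j := vpick (T j).
have tT j : t j \in T j by exact: memv_pick.
have nt j : t j != 0 by rewrite vpick0; have [] := sT j.
have mI j : maxideal (ann (t j)) := ann_maxideal (sT j) (tT j) (nt j).
have sI j : @stable _ _ (regmod A) (ann (t j)) by have [] := mI j.
have cT j : cyc (t j) = T j.
  have [st nT cT] := sT j; apply/eqP.
  by rewrite eqEsubv (cyc_sub st (tT j)) (cT _ (tT j) (nt j)).
have nfull I : maxideal I -> ~ linked fullv I.
  move=> _ [c /memv_conductor cI /negP[]].
  by rewrite -[c]mul1r cI ?memvf.
pose E a b := `[< linked (ann (t a)) (ann (t b)) >].
pose F i a := `[< linked (Q i) (ann (t a)) >].
have Qmax i a : F i a -> maxideal (Q i).
  by move=> /asboolP l; case: (mQ i) => // Qf; case: (nfull _ (mI a)); rewrite -Qf.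
apply: (@card_le_by_class _ _ E F).
- by move=> a; apply/asboolP/linked_refl.
- by move=> a b; apply/idP/idP => /asboolP l; apply/asboolP; apply: linked_sym.
- move=> b a c /asboolP ab /asboolP bc; apply/asboolP.
  exact: linked_trans ab bc.
- move=> i a b Fa Fb; apply/asboolP; have mQi := Qmax i a Fa.
  move: Fa Fb => /asboolP la /asboolP lb.
  by apply: linked_trans lb => //; apply: linked_sym.
move=> a; set I := ann (t a); pose d := dim_hom I I.
have d0 : (0 < d)%N by exact: dim_hom_gt0 (mI a).
rewrite -(leq_pmul2r d0).
have left : (#|E a| * d <= \dim (killed I (\sum_j T j)%VS))%N.
  apply: (@leq_trans (\sum_j \dim (killed I (T j)))).
    rewrite -sum_nat_const big_mkcond /=; apply: leq_sum => j _.
    case: ifP => // /asboolP laj; rewrite -cT dim_killed_cyc.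
    exact: (dim_homr _ (mI a) (sI j)).
  have dir : directv (\sum_j killed I (T j)).
    apply/directv_sum_independent => u uT u0 j _; apply: iT u0 j => j.
    by have /memv_killed[] := uT j isT.
  move/directvP: dir => /= <-; apply/dimvS/subv_sumP => j _.
  exact/killedS/(sumv_sup j).
apply: leq_trans left (leq_trans (dQ I (mI a)) _).
rewrite -sum_nat_const [in X in (_ <= X)%N]big_mkcond /=; apply: leq_sum => i _.
case: ifP => [Fi|/negP nF]; last first.
  by rewrite dim_hom0 // => l; apply: nF; apply/asboolP.
have mQi := Qmax i a Fi; move/asboolP: Fi => l.
by apply: (dim_homl mQi (sI a)); apply: (linked_sym mQi (mI a)).
Qed.

(** By dX, at most the n simple modules A / Q i account for the socle of X; the
    simple module S accounts for one more in the socle of B. *)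
Section Middle.
Variables (B : fdmod A) (X : {vspace B}) (n : nat) (Q : 'I_n -> {vspace A}).
Hypothesis mQ : forall i, maxideal (Q i) \/ Q i = fullv.
Hypothesis dX : forall I, maxideal I ->
  (\dim (killed I X) <= \sum_i dim_hom (Q i) I)%N.
Variables (J : finType) (T : J -> {vspace B}).
Hypotheses (sT : forall j, simple (T j)) (iT : independent T).

Lemma card_simple_left : (forall j, (T j <= X)%VS) -> (#|J| <= n)%N.
Proof.
move=> TX; rewrite -[n]card_ord; apply: (card_simple_le sT iT mQ) => I mI.
apply: leq_trans (dX mI); apply: dimvS; apply: killedS.
by apply/subv_sumP => j _.
Qed.

Lemma card_simple_middle (U : fdmod A) (g : 'Hom(B, U)) (S : {vspace U}) :
  equivariant g -> (lker g <= X)%VS -> simple S ->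
  (forall j, (g @: T j <= S)%VS) -> (#|J| <= n.+1)%N.
Proof.
move=> eg kX sS TS; rewrite -[n.+1]card_ord; pose s := vpick S.
have sInS : s \in S by exact: memv_pick.
have ns : s != 0 by rewrite vpick0; have [] := sS.
have cS : cyc s = S.
  have [st nT cT] := sS; apply/eqP.
  by rewrite eqEsubv (cyc_sub st sInS) (cT _ sInS ns).
have ms := ann_maxideal sS sInS ns.
pose Q' k := oapp Q (ann s) (unlift ord0 k).
apply: (@card_simple_le _ _ _ _ Q' sT iT) => [k|I mI].
  by rewrite /Q'; case: (unliftP ord0 k) => [i _|_] /=; [exact: mQ|left].
rewrite big_ord_recl {1}/Q' unlift_none /=.
have -> : \sum_(i < n) dim_hom (Q' (lift ord0 i)) I = \sum_i dim_hom (Q i) I.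
  by apply: eq_bigr => i _; rewrite /Q' liftK.
set W := (\sum_j T j)%VS.
rewrite -(limg_ker_dim g (killed I W)) addnC leq_add //.
  have [si _ _] := mI; have [ss _ _] := ms.
  have img : (g @: killed I W <= killed I (cyc s))%VS.
    apply/subvP => y /memv_imgP[w /memv_killed[wW wI] ->]; apply/memv_killed.
    split; last by move=> a aI; rewrite -eg wI ?linear0.
    rewrite cS; have : (g @: W <= S)%VS by rewrite limg_sum; apply/subv_sumP => j _.
    by move/subvP; apply; rewrite memv_img.
  apply: leq_trans (dimvS img) _; rewrite dim_killed_cyc.
  case: (pselect (linked I (ann s))) => [l|nl]; last by rewrite dim_hom0.
  apply: (@leq_trans (dim_hom I I)).
    by apply: dim_homr => //; apply: linked_sym.
  by apply: dim_homl => //; apply: linked_sym.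
apply: leq_trans (dX mI); apply: dimvS; apply/subvP => y.
rewrite memv_cap => /andP[/memv_killed[yW yI] yk]; apply/memv_killed; split=> //.
exact: (subvP kX).
Qed.

End Middle.
End Counting.

(** * The Jacobson radical and primitive idempotents *)

Section Radical.
Variables (K : fieldType) (A : falgType K).
Implicit Types (I N : {vspace A}) (a c e f x y z : A).
Local Notation reg := (regmod A).

Local Notation Ax x := (@cyc _ _ reg x).

Lemma memv_left_ideal x y : y \in Ax x <-> exists a, y = a * x.
Proof. exact: (@memv_cyc _ _ reg). Qed.

Definition in_radical x : Prop := forall I, maxideal I -> x \in I.

Lemma maxideal_exists N :
  @stable _ _ reg N -> 1 \notin N -> exists2 I, maxideal I & (N <= I)%VS.
Proof.
move=> sN n1; pose ok I := [/\ @stable _ _ reg I, 1 \notin I & (N <= I)%VS].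
have [I [sI nI NI] maxI] := @max_dim _ _ reg ok N (And3 sN n1 (subvv N)).
exists I => //; split=> // c nc; pose I' := (I + Ax c)%VS.
have sI' : @stable _ _ reg I' by apply: stable_add => //; apply: stable_cyc.
have: 1 \in I'.
  apply/negPn/negP => n1'; case/negP: nc.
  have II' : (I' <= I)%VS.
    rewrite -(dimv_leqif_sup (addvSl I _)) eqn_leq dimvS ?addvSl //=.
    by apply: maxI; split=> //; apply: subv_trans NI (addvSl _ _).
  apply: (subvP II'); apply: (subvP (addvSr I _)); exact: (@cyc_id _ _ reg).
case/memv_addP=> i iI [w /memv_left_ideal[x ->] E]; exists x.
by rewrite E opprD addrCA subrr addr0 memvN.
Qed.

Lemma radical_unit z : in_radical z -> exists v, v * (1 + z) = 1.
Proof.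
move=> zJ; case: (boolP (1 \in Ax (1 + z))).
  by case/memv_left_ideal=> v /esym; exists v.
case/(maxideal_exists (@stable_cyc _ _ reg _)) => I mI sub.
have [sI n1 _] := mI; case/negP: n1.
rewrite -[1](addrK z) memvB ?zJ // (subvP sub) //; exact: (@cyc_id _ _ reg).
Qed.

(** Fitting's lemma: right multiplication by a large power w of y is bijective
    on A w, and the element that it maps to w is idempotent. *)
Lemma non_nilpotent_idempotent y : (forall k, y ^+ k != 0) ->
  exists f, [/\ f * f = f, f != 0 & exists c, f = c * y].
Proof.
move=> ny; pose d k := \dim (Ax (y ^+ k.+1)).
have [k kmin] : exists k, forall l, (d k <= d l)%N.
  pose P n := `[< exists k, d k = n >].
  have exP : exists n, P n by exists (d 0%N); apply/asboolP; exists 0%N.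
  case: (ex_minnP exP) => n /asboolP[k <-] mn; exists k => l; apply: mn.
  by apply/asboolP; exists l.
set w := y ^+ k.+1; pose Aw := Ax w.
have sAw : @stable _ _ reg Aw by exact: stable_cyc.
have img : (@ev _ _ reg w @: Aw)%VS = Aw.
  have le : (@ev _ _ reg w @: Aw <= Aw)%VS.
    apply/subvP => _ /memv_imgP[a _ ->]; rewrite evE; apply: (sAw a).
    exact: (@cyc_id _ _ reg).
  apply/eqP; rewrite eqEdim le /=; apply: (leq_trans (kmin (k.+1 + k)%N)).
  apply: dimvS; apply/subvP => _ /memv_left_ideal[a ->].
  have -> : a * y ^+ (k.+1 + k).+1 = @ev _ _ reg w (a * w).
    by rewrite evE /= -addnS exprD mulrA.
  by apply: memv_img; apply/memv_left_ideal; exists a.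
have inj (x : reg) : x \in Aw -> x * w = 0 -> x = 0.
  move=> xAw xw; apply/eqP; rewrite -memv0.
  suff <- : (Aw :&: lker (@ev _ _ reg w) = 0)%VS.
    by rewrite memv_cap xAw memv_ker evE; apply/eqP.
  have := limg_ker_dim (@ev _ _ reg w) Aw; rewrite img -[RHS]add0n.
  by move/addIn/eqP; rewrite dimv_eq0 => /eqP.
have : w \in (@ev _ _ reg w @: Aw)%VS by rewrite img (@cyc_id _ _ reg).
case/memv_imgP=> f fAw wE; have fw : w = f * w := etrans wE (@evE _ _ reg w f).
exists f; split.
- apply/eqP; rewrite -subr_eq0; apply/eqP/inj.
    by rewrite memvB //; apply: (sAw f).
  by rewrite mulrBl -mulrA -fw -fw subrr.
- by apply: contraTneq (ny k.+1) => f0; rewrite -/w fw f0 mul0r eqxx.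
- by case/memv_left_ideal: fAw => c ->; exists (c * y ^+ k); rewrite /= /w exprSr mulrA.
Qed.

Lemma idempotent_outside_radical N x :
  @stable _ _ reg N -> x \in N -> ~ in_radical x ->
  exists f, [/\ f \in N, f * f = f & f != 0].
Proof.
move=> sN xN /existsNP[I /not_implyP[mI /negP xI]]; have [sI n1 /(_ x xI)[y yI]] := mI.
have zk k : (y * x) ^+ k - 1 \in I.
  elim: k => [|k IH]; first by rewrite expr0 subrr mem0v.
  have -> : (y * x) ^+ k.+1 - 1 = (y * x) ^+ k * (y * x - 1) + ((y * x) ^+ k - 1).
    by rewrite mulrBr mulr1 exprSr addrA subrK.
  by rewrite memvD //; apply: (sI ((y * x) ^+ k)).
have [k|f [ff nf [c fE]]] := @non_nilpotent_idempotent (y * x).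
  by apply: contraNneq n1 => z0; have := zk k; rewrite z0 sub0r memvN.
by exists f; split=> //; rewrite fE mulrA; apply: (sN (c * y)).
Qed.

(** For e primitive, J e is the unique maximal submodule of A e: an
    idempotent f = f e of N would give the decomposition of e into e f and
    e - e f. *)
Lemma primitive_proper_radical e N :
  primitive_idempotent e -> @stable _ _ reg N ->
  (forall a, a \in N -> a * e = a) -> e \notin N ->
  forall x, x \in N -> in_radical x.
Proof.
move=> [ee ne pe] sN Ne eN x xN; apply: contrapT => nJ.
have [f [fN ff nf]] := idempotent_outside_radical sN xN nJ.
have fe := Ne f fN; have efef : (e * f) * (e * f) = e * f.
  by rewrite -mulrA [f * _]mulrA fe ff.
have eef : e * (e * f) = e * f by rewrite mulrA ee.
have efe : e * f * e = e * f by rewrite -mulrA fe.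
have [|||||ef0|ef1] := pe (e * f) (e - e * f).
- exact: efef.
- by rewrite /Defs.idempotent mulrBr !mulrBl ee efef eef efe subrr subr0.
- by rewrite mulrBr efe efef subrr.
- by rewrite mulrBl eef efef subrr.
- by rewrite addrC subrK.
- by case/eqP: nf; rewrite -ff -{1}fe -mulrA ef0 mulr0.
- move/eqP: ef1; rewrite subr_eq0 => /eqP ef1; case/negP: eN.
  by rewrite ef1; apply: (sN e).
Qed.

(** Among the idempotents outside I, one that generates a left ideal of least
    dimension is primitive. *)
Lemma primitive_outside I : maxideal I ->
  exists2 e, primitive_idempotent e & e \notin I.
Proof.
move=> mI; have [sI n1 _] := mI.
pose P n := `[< exists e, [/\ e * e = e, e \notin I & \dim (Ax e) = n] >].
have exP : exists n, P n.
  by exists (\dim (Ax 1)); apply/asboolP; exists 1; rewrite mulr1.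
case: (ex_minnP exP) => n /asboolP[e [ee eI <-]] mn; exists e => //.
(* A f = A e contains g, so that g = c f for some c and g = g g = c f g = 0 *)
have small f g : f * f = f -> g * g = g -> f * g = 0 -> g * f = 0 ->
    e = f + g -> f \notin I -> g = 0.
  move=> ff gg fg gf eE fI.
  have fe : f * e = f by rewrite eE mulrDr ff fg addr0.
  have ge : g * e = g by rewrite eE mulrDr gg gf add0r.
  have sub : (Ax f <= Ax e)%VS.
    by apply: cyc_sub; [exact: stable_cyc|apply/memv_left_ideal; exists f; rewrite /= fe].
  have le : (Ax e <= Ax f)%VS.
    rewrite -(dimv_leqif_sup sub) eqn_leq dimvS //=; apply: mn.
    by apply/asboolP; exists f.
  have : g \in Ax f by apply/(subvP le)/memv_left_ideal; exists g; rewrite /= ge.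
  by case/memv_left_ideal=> c gE; rewrite -gg {1}gE /= -mulrA fg mulr0.
split=> //; first by apply: contraNneq eI => ->; rewrite mem0v.
move=> f g ff gg fg gf eE; case: (boolP (f \in I)) => [fI|fI].
  left; apply: (small g f) => //; first by rewrite addrC.
  by apply: contra eI => gI; rewrite eE memvD.
by right; apply: (small f g).
Qed.

End Radical.

Section UniserialModules.
Variables (K : fieldType) (A : falgType K) (U : fdmod A).

Lemma serial_radical : @serial _ _ U 0 fullv -> (fullv : {vspace U}) != 0%VS ->
  exists R : {vspace U}, [/\ stable R, R != fullv &
    forall P : {vspace U}, stable P -> P != fullv -> (P <= R)%VS].
Proof.
move=> ser nU; pose ok (R : {vspace U}) := stable R /\ R != fullv.
have ok0 : ok 0%VS by split; [exact: stable0|rewrite eq_sym].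
have [R [sR nR] maxR] := max_dim ok0; exists R; split=> // P sP nP.
have [] := ser P R sP sR; rewrite ?sub0v ?subvf // => RP.
by rewrite (_ : P = R) ?subvv //; apply/eqP; rewrite eq_sym eqEdim RP maxR.
Qed.

(** All simple submodules of a uniserial module coincide, and the image of a
    simple module is simple or zero. *)
Lemma serial_socle : @serial _ _ U 0 fullv -> (fullv : {vspace U}) != 0%VS ->
  exists2 S : {vspace U}, simple S &
    forall (M : fdmod A) (g : 'Hom(M, U)) T,
      equivariant g -> simple T -> (g @: T <= S)%VS.
Proof.
move=> ser nU; have [S sS _] := simple_exists (@stablef _ _ U) nU.
have [stS nS _] := sS; exists S => // M g T eg sT.
have [->|nT] := eqVneq (g @: T)%VS 0%VS; first exact: sub0v.
have sgT := simple_img eg sT nT; have [stT _ _] := sgT.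
have [] := ser (g @: T)%VS S stT stS; rewrite ?sub0v ?subvf //.
by move=> Sg; rewrite (simple_sub sgT stS Sg nS) subvv.
Qed.

End UniserialModules.

(** * Almost split sequences ending in a uniserial module *)

Section Core.
Variables (K : fieldType) (A : falgType K) (B U : fdmod A) (g : 'Hom(B, U)).
Variables (n m : nat) (W : 'I_n -> {vspace B}).
Local Notation reg := (regmod A).
Local Notation X := (lker g).

Hypothesis eg : equivariant g.
Hypothesis g_surj : forall y, exists p, g p = y.
Hypothesis stW : forall i, stable (W i).
Hypothesis nW : forall i, W i != 0%VS.
Hypothesis iW : independent W.
Hypothesis fullW : (\sum_i W i)%VS = fullv.
Hypothesis serU : @serial _ _ U 0 fullv.

(* a section of g would be determined by its value p at a generator y *)
Hypothesis nonsplit : forall y p, (fullv <= cyc y)%VS -> g p = y ->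
  ~ (forall a, act a y = 0 -> act a p = 0).
(* the sequence becomes split modulo each nonzero submodule Y of X *)
Hypothesis left_almost : forall Y : {vspace B},
  stable Y -> Y != 0%VS -> (Y <= X)%VS ->
  forall y, exists2 p, g p = y & forall a, act a y = 0 -> act a p \in Y.
(* each nonsplit epimorphism from A / I to U = A y lifts to B *)
Hypothesis right_almost : forall y I, @stable _ _ reg I ->
  (forall a, a \in I -> act a y = 0) ->
  (forall c, act c y = y -> ~ forall a, act a y = 0 -> a * c \in I) ->
  exists2 p, g p = y & forall a, a \in I -> act a p = 0.
Hypothesis multiserial : forall e, primitive_idempotent e ->
  exists V : 'I_m -> {vspace A},
    [/\ forall i, @stable _ _ reg (V i), forall i, @serial _ _ reg 0 (V i) &
        forall a, a \in (\sum_i V i)%VS <-> exists2 x, in_radical x & a = x * e].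

Lemma target_nonzero : (fullv : {vspace U}) != 0%VS.
Proof.
apply/eqP => U0; apply: (nonsplit (y := 0) (p := 0)).
- by rewrite U0 sub0v.
- exact: linear0.
- by move=> a _; rewrite act0r.
Qed.

Lemma simple_summand : exists T : 'I_n -> {vspace B},
  (forall i, simple (T i)) /\ (forall i, (T i <= W i)%VS).
Proof.
have /choice[T PT] : forall i, exists T, simple T /\ (T <= W i)%VS.
  by move=> i; have [T] := simple_exists (stW (i := i)) (nW i); exists T.
by exists T; split=> i; have [] := PT i.
Qed.

Lemma independentS (T : 'I_n -> {vspace B}) :
  (forall i, (T i <= W i)%VS) -> independent T.
Proof. by move=> TW t tT; apply: iW => i; apply: (subvP (TW i)). Qed.

(** The kernel of A e -> M sending a to a x, for e idempotent. *)
Definition relations (M : fdmod A) (e : A) (x : M) : {vspace A} :=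
  (@cyc _ _ reg e :&: ann x)%VS.

Lemma memv_relations (M : fdmod A) e (x : M) a : e * e = e ->
  a \in relations e x <-> a * e = a /\ act a x = 0.
Proof.
move=> ee; rewrite memv_cap memv_ann; split.
  by case/andP=> /memv_left_ideal[b ->] /eqP ->; rewrite -mulrA ee.
case=> ae /eqP ->; rewrite andbT; apply/memv_left_ideal; by exists a.
Qed.

Lemma stable_relations (M : fdmod A) e (x : M) : @stable _ _ reg (relations e x).
Proof. by apply: stable_cap; [exact: stable_cyc | exact: stable_ann]. Qed.

Lemma dim_relations e (x y : U) :
  act e x = x -> act e y = y -> cyc x = fullv -> cyc y = fullv ->
  \dim (relations e x) = \dim (relations e y).
Proof.
have dimE (z : U) : act e z = z -> cyc z = fullv ->
    (\dim (relations e z) + \dim (fullv : {vspace U}) = \dim (@cyc _ _ reg e))%N.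
  move=> ez zf; rewrite -(limg_ker_dim (ev z) (@cyc _ _ reg e)); congr (_ + \dim _)%N.
  apply/esym/eqP; rewrite eqEsubv subvf /= -zf; apply/subvP => _ /memv_cyc[a ->].
  rewrite -[X in act a X]ez actA -evE memv_img //; apply/memv_left_ideal; by exists a.
move=> ex ey xf yf; apply: (@addIn (\dim (fullv : {vspace U}))).
by rewrite !dimE.
Qed.

(** A projective cover A e of U = A u, with e u = u. *)
Lemma projective_cover : exists (R : {vspace U}) (e : A) (u : U),
  [/\ stable R,
      forall y, y \notin R -> cyc y = fullv,
      primitive_idempotent e,
      act e u = u /\ u \notin R &
      (forall a, a * e = a -> act a u \in R -> in_radical a) /\
      (forall x, in_radical x -> act (x * e) u \in R)].
Proof.
have [R [sR nR maxR]] := serial_radical serU target_nonzero.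
have gen y : y \notin R -> cyc y = fullv.
  move=> yR; apply/eqP/negPn/negP => ny; case/negP: yR.
  by rewrite (subvP (maxR _ (@stable_cyc _ _ U y) ny)) ?cyc_id.
have /subvPn[u0 _ u0R] : ~~ (fullv <= R)%VS.
  by apply: contra nR => Rf; rewrite eqEsubv subvf.
have mI y : y \notin R -> maxideal (ev y @^-1: R)%VS.
  move=> yR; split.
  - exact: (stable_preim (@ev_equivariant _ _ U y)).
  - by rewrite -memv_preim evE act1.
  move=> c; rewrite -memv_preim evE => cy.
  have : y \in cyc (act c y) by rewrite gen ?memvf.
  case/memv_cyc=> x xE; exists x.
  by rewrite -memv_preim evE actBl act1 -actA -xE subrr mem0v.
have [e pe eI] := primitive_outside (mI u0 u0R); have [ee ne _] := pe.
pose u := act e u0; have eu : act e u = u by rewrite /u actA ee.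
have uR : u \notin R by move: eI; rewrite -memv_preim evE.
exists R, e, u; split=> //; split; last first.
  move=> x xJ; rewrite -actA eu.
  by have := xJ _ (mI u uR); rewrite -memv_preim evE.
pose N := (@cyc _ _ reg e :&: (ev u @^-1: R))%VS.
have memN a : a \in N <-> a * e = a /\ act a u \in R.
  rewrite memv_cap -memv_preim evE; split.
    by case/andP=> /memv_left_ideal[b ->] ->; rewrite -mulrA ee.
  case=> ae ->; rewrite andbT; apply/memv_left_ideal; by exists a.
move=> a ae au; apply: (primitive_proper_radical pe (N := N)).
- apply: stable_cap; first exact: stable_cyc.
  exact: (stable_preim (@ev_equivariant _ _ U u)).
- by move=> b /memN[].
- by apply/negP => /memN[_]; rewrite eu; apply/negP.
- exact/memN.
Qed.

(** The sequence splits modulo each nonzero submodule of X, but not over X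
    itself: these are the hypotheses of dim_killed_le, with the relations of u
    as L. *)
Lemma socle_left_bound (e : A) (u : U) k (V : 'I_k -> {vspace A}) :
  e * e = e -> act e u = u -> cyc u = fullv ->
  (forall i, @stable _ _ reg (V i)) -> (forall i, @serial _ _ reg 0 (V i)) ->
  (relations e u <= \sum_i V i)%VS ->
  exists Q : 'I_k -> {vspace A},
    (forall i, maxideal (Q i) \/ Q i = fullv) /\
    forall I, maxideal I -> (\dim (killed I X) <= \sum_i dim_hom (Q i) I)%N.
Proof.
move=> ee eu uf sV serV LV; set L := relations e u in LV.
have sL : @stable _ _ reg L by exact: stable_relations.
have [Q [mQ dQ]] := dim_top_le sV serV sL LV; exists Q; split=> // I mI.
apply: leq_trans (dQ I mI); have [p0 gp0] := g_surj u.
apply: (dim_killed_le (p0 := p0)) => //; first exact: stable_lker.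
- move=> x; rewrite memv_ker => /eqP gx Lx.
  apply: (nonsplit (y := u) (p := act e (p0 - x))); rewrite ?uf //.
    by rewrite eg linearB /= gp0 gx subr0.
  move=> a au; rewrite actA Lx //; apply/memv_relations => //.
  by rewrite -mulrA ee -actA eu.
- move=> Y sY YX nY; have [p gp pY] := left_almost sY nY YX u.
  exists (p0 - p); first by rewrite memv_ker linearB /= gp0 gp subrr.
  by move=> l /(memv_relations _ _ ee)[_ lu]; rewrite subKr pY.
Qed.
(** Otherwise a second simple submodule of W i, taken together with one simple
    submodule in each summand, would give n + 1 independent simple submodules of
    B, whose socle has length at most k + 1. *)
Lemma unique_simple k (Q : 'I_k -> {vspace A}) (T : 'I_n -> {vspace B}) :
  (forall i, maxideal (Q i) \/ Q i = fullv) ->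
  (forall I, maxideal I -> (\dim (killed I X) <= \sum_i dim_hom (Q i) I)%N) ->
  (k < n)%N -> (forall i, simple (T i)) -> (forall i, (T i <= W i)%VS) ->
  forall i (P : {vspace B}), stable P -> P != 0%VS -> (P <= W i)%VS ->
    (T i <= P)%VS.
Proof.
move=> mQ dQ kn sT TW i P sP nP PW.
have [S sS SP] := simple_exists sP nP; have [stS nS _] := sS.
have [stT nT _] := sT i.
have [cap0|ncap] := eqVneq (T i :&: S)%VS 0%VS; last first.
  have sc := stable_cap stT stS.
  have TE : (T i :&: S)%VS = T i by apply: simple_sub; rewrite ?capvSl.
  by rewrite -TE (subv_trans (capvSr _ _)).
pose T' (o : 'I_n.+1) := oapp T S (unlift ord0 o).
have sT' o : simple (T' o) by rewrite /T'; case: unliftP => [j _|_] /=.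
have iT' : independent T'.
  move=> t tT'; rewrite big_ord_recl => t0.
  have t0S : t ord0 \in S by have := tT' ord0; rewrite /T' unlift_none.
  have tl j : t (lift ord0 j) \in T j by have := tT' (lift ord0 j); rewrite /T' liftK.
  pose w j := t (lift ord0 j) + (if j == i then t ord0 else 0).
  have wW j : w j \in W j.
    apply: memvD; first exact: (subvP (TW j)).
    case: eqP => [->|_]; last exact: mem0v.
    by apply: (subvP PW); apply: (subvP SP).
  have w0 : \sum_j w j = 0.
    by rewrite big_split /= -big_mkcond big_pred1_eq addrC.
  have wz := iW wW w0.
  have tS0 : t ord0 = 0.
    apply/eqP; rewrite -memv0 -cap0 memv_cap t0S andbT.
    have /eqP := wz i; rewrite /w eqxx addrC addr_eq0 => /eqP->.
    by rewrite memvN tl.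
  move=> o; case: (unliftP ord0 o) => [j ->|-> //].
  by have := wz j; rewrite /w tS0 if_same addr0.
have [S0 sS0 imS0] := serial_socle serU target_nonzero.
have := card_simple_middle mQ dQ sT' iT' eg (subvv _) sS0 (fun o => imS0 _ _ _ eg (sT' o)).
by rewrite card_ord ltnS leqNgt kn.
Qed.

Lemma summands_le k (Q : 'I_k -> {vspace A}) :
  (forall i, maxideal (Q i) \/ Q i = fullv) ->
  (forall I, maxideal I -> (\dim (killed I X) <= \sum_i dim_hom (Q i) I)%N) ->
  (n <= k.+1)%N.
Proof.
move=> mQ dQ; have [T [sT TW]] := simple_summand.
have [S0 sS0 imS0] := serial_socle serU target_nonzero.
have := card_simple_middle mQ dQ sT (independentS TW) eg (subvv _) sS0
  (fun o => imS0 _ _ _ eg (sT o)).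
by rewrite card_ord.
Qed.

(** When U is simple, no simple submodule of B maps onto U, so that the socle
    of B is that of X. *)
Lemma summands_le_simple k (Q : 'I_k -> {vspace A}) :
  (forall y : U, y != 0 -> cyc y = fullv) ->
  (forall i, maxideal (Q i) \/ Q i = fullv) ->
  (forall I, maxideal I -> (\dim (killed I X) <= \sum_i dim_hom (Q i) I)%N) ->
  (n <= k)%N.
Proof.
move=> Us mQ dQ; have [T [sT TW]] := simple_summand.
rewrite -[n]card_ord; apply: (card_simple_left mQ dQ sT (independentS TW)) => i.
have [stT nT _] := sT i; apply/negPn/negP => /subvPn[t tT].
rewrite memv_ker => gt.
apply: (nonsplit (y := g t) (p := t)); rewrite ?Us // => a.
rewrite -eg => gat; apply/eqP/negPn/negP => nat; case/eqP: gt.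
have sc := stable_cap stT (stable_lker eg).
have TE : (T i :&: X)%VS = T i.
  apply: simple_sub; rewrite ?capvSl //.
  apply: contraNneq nat => c0; rewrite -memv0 -c0 memv_cap memv_ker gat eqxx.
  by rewrite andbT; apply: stT.
by apply/eqP; rewrite -memv_ker; move: tT; rewrite -TE memv_cap => /andP[].
Qed.

(** Here L1 is a maximal submodule of the relations L of u, and w is the image
    of e under a homomorphism A e / L1 -> B that gives an epimorphism onto U
    after composition with g; the conclusion is that it is a monomorphism. The
    relations L' of g w contain the relations Lw of w strictly, as g is not
    split, and L' has the same dimension as L. If Lw were not contained in L,
    then L' would not be L, and Lw u would be a nonzero submodule of the
    uniserial module U, hence contain its simple submodule L (g w), so that
    dim Lw would be at least dim L. *)
Lemma relations_component (R : {vspace U}) (e : A) (u : U) (L1 : {vspace A}) (w : B) :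
  e * e = e -> (forall y, y \notin R -> cyc y = fullv) ->
  act e u = u -> u \notin R ->
  @stable _ _ reg L1 -> (L1 <= relations e u)%VS ->
  (forall P, @stable _ _ reg P -> (L1 <= P)%VS -> (P <= relations e u)%VS ->
    P = L1 \/ P = relations e u) ->
  act e w = w -> g w \notin R -> (L1 <= relations e w)%VS ->
  relations e w = L1.
Proof.
move=> ee gen eu uR sL1 L1L maxL1 ew gwR L1w.
set L := relations e u in L1L maxL1 *; set Lw := relations e w in L1w *.
pose u' := g w; pose L' := relations e u'.
have eu' : act e u' = u' by rewrite -eg ew.
have sL : @stable _ _ reg L by exact: stable_relations.
have sL' : @stable _ _ reg L' by exact: stable_relations.
have sLw : @stable _ _ reg Lw by exact: stable_relations.
have LwL' : (Lw <= L')%VS.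
  apply/subvP => a /(memv_relations _ _ ee)[ae aw]; apply/memv_relations => //.
  by rewrite -eg aw linear0.
have nL'Lw : ~~ (L' <= Lw)%VS.
  apply/negP => /subvP le; apply: (nonsplit (y := u') (p := w)); rewrite ?gen //.
  move=> a au'; have /le/(memv_relations _ _ ee)[_] : a * e \in L'.
    by apply/memv_relations; rewrite // -mulrA ee -actA eu'.
  by rewrite -actA ew.
have dimL : \dim L = \dim L' by apply: dim_relations; rewrite // gen.
have ltLw : (\dim Lw < \dim L)%N.
  by rewrite dimL ltn_neqAle dimvS // andbT (dimv_leqif_sup LwL').
suff LwL : (Lw <= L)%VS.
  have [//|LwE] := maxL1 Lw sLw L1w LwL.
  by move: ltLw; rewrite LwE ltnn.
have sc : @stable _ _ reg (L :&: L')%VS by exact: stable_cap.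
have evA a (x : U) : ev x a = act a x by exact: evE.
have L1L' : (L1 <= L')%VS := subv_trans L1w LwL'.
have L1c : (L1 <= L :&: L')%VS by rewrite subv_cap; apply/andP; split.
have [cE|cE] := maxL1 _ sc L1c (capvSl _ _).
- have [//|nLw] := boolP (Lw <= L)%VS.
  have capL : (L :&: lker (ev u') = L1)%VS.
    rewrite -cE; apply/vspaceP => a; rewrite [LHS]memv_cap [RHS]memv_cap memv_ker evA.
    apply: andb_id2l => /(memv_relations _ _ ee)[ae _].
    by apply/eqP/idP => [au|/(memv_relations _ _ ee)[] //]; apply/memv_relations.
  have L1cap : (L1 <= Lw :&: lker (ev u))%VS.
    rewrite subv_cap L1w; apply: subv_trans L1L _; exact: capvSr.
  have notle : ~ (ev u' @: L <= ev u @: Lw)%VS.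
    move=> /dimvS le; have := limg_ker_dim (ev u') L; rewrite capL => dL.
    have := limg_ker_dim (ev u) Lw => dLw.
    have := leq_add (dimvS L1cap) le; rewrite dL dLw.
    by rewrite leqNgt ltLw.
  have stI : stable (ev u @: Lw)%VS by apply: stable_img (@ev_equivariant _ _ U u) _.
  have stI' : stable (ev u' @: L)%VS by apply: stable_img (@ev_equivariant _ _ U u') _.
  have [] := serU stI stI'; rewrite ?sub0v ?subvf // => le.
  pose P := (L :&: (ev u' @^-1: (ev u @: Lw)))%VS.
  have sP : @stable _ _ reg P.
    by apply: stable_cap => //; apply: stable_preim (@ev_equivariant _ _ U u') _.
  have L1P : (L1 <= P)%VS.
    apply/subvP => a aL1; rewrite memv_cap (subvP L1L) //= -memv_preim evA.
    by have /subvP/(_ a aL1)/(memv_relations _ _ ee)[_ ->] := L1L'; rewrite mem0v.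
  have [PE|PE] := maxL1 P sP L1P (capvSl _ _).
    case/negP: nLw; apply/subvP => a aLw.
    have [ae _] := proj1 (memv_relations _ _ ee) aLw.
    apply/memv_relations => //; split=> //.
    have auI : ev u a \in (ev u @: Lw)%VS by apply: memv_img.
    have /memv_imgP[l lL lE] := subvP le _ auI.
    have : l \in L1 by rewrite -PE memv_cap lL -memv_preim -lE.
    move/(subvP L1L')/(memv_relations _ _ ee) => [_ lu'].
    by rewrite -evA lE evA.
  case: notle; apply/subvP => _ /memv_imgP[l lL ->].
  by move: lL; rewrite -{1}PE memv_cap -memv_preim => /andP[].
- have LL' : (L <= L')%VS by rewrite -cE capvSr.
  by have /eqP -> : L == L' by rewrite eqEdim LL' dimL leqnn.
Qed.

(** The kernel of A e / L1 -> U is the socle L / L1 of A e / L1 embedded by w in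
    a summand with a simple socle. Both L w and V j w contain this socle, and
    comparing v w = l w gives an element v of V j in L, hence in L1, which
    kills w. *)
Lemma summands_le_multiserial : (2 <= m)%N -> (n <= m)%N.
Proof.
move=> m2; rewrite leqNgt; apply/negP => mn.
have [R [e [u [sR gen pe [eu uR] [Jin Jout]]]]] := projective_cover.
have [ee _ _] := pe; have uf := gen u uR.
have [V [sV serV memV]] := multiserial pe.
set L := relations e u; have sL : @stable _ _ reg L by exact: stable_relations.
have memVR a : a \in (\sum_i V i)%VS <-> a * e = a /\ act a u \in R.
  split=> [/memV[x xJ ->]|[ae au]]; first by rewrite -mulrA ee Jout.
  by apply/memV; exists a => //; apply: Jin.
have LV : (L <= \sum_i V i)%VS.
  apply/subvP => a /(memv_relations _ _ ee)[ae au]; apply/memVR.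
  by rewrite au mem0v.
have [Q [mQ dQ]] := socle_left_bound ee eu uf sV serV LV.
have [R0|nR] := eqVneq R 0%VS.
  have := summands_le_simple _ mQ dQ; rewrite leqNgt mn => /(_ _)/negP; case=> // y ny.
  by apply: gen; rewrite R0 memv0.
(* some V j maps onto R, because the images of the V i form a chain *)
have [j Vj] : exists j, (R <= ev u @: V j)%VS.
  have m0 : (0 < m)%N by exact: leq_trans m2.
  pose j := [arg max_(i > Ordinal m0) \dim (ev u @: V i)%VS].
  have jmax i : (\dim (ev u @: V i)%VS <= \dim (ev u @: V j)%VS)%N.
    by rewrite /j; case: arg_maxnP => // k _; apply.
  exists j; apply: (@subv_trans _ _ (ev u @: (\sum_i V i))%VS).
    apply/subvP => r rR; have : r \in cyc u by rewrite uf memvf.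
    case/memv_cyc=> a rE; rewrite rE -[X in act a X]eu actA -evE memv_img //.
    by apply/memVR; rewrite -mulrA ee -actA eu -rE.
  rewrite limg_sum; apply/subv_sumP => i _.
  have sI k : stable (ev u @: V k)%VS by apply: stable_img (@ev_equivariant _ _ U u) (sV k).
  have [] := serU (sI i) (sI j); rewrite ?sub0v ?subvf // => le.
  by have /eqP -> : (ev u @: V j == ev u @: V i)%VS by rewrite eqEdim le jmax.
have [LVj|nLVj] := boolP (L <= V j)%VS.
  have LV1 : (L <= \sum_(i < 1) V j)%VS by rewrite big_ord1.
  have [Q1 [mQ1 dQ1]] := socle_left_bound ee eu uf (fun=> sV j) (fun=> serV j) LV1.
  by have := leq_ltn_trans m2 mn; rewrite ltnNge (summands_le mQ1 dQ1).
have scap : @stable _ _ reg (L :&: V j)%VS by exact: stable_cap.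
pose ok P := [/\ @stable _ _ reg P, (L :&: V j <= P)%VS, (P <= L)%VS & P != L].
have ok0 : ok (L :&: V j)%VS.
  split=> //; first exact: capvSl.
  by apply: contra nLVj => /eqP <-; apply: capvSr.
have [L1 [sL1 VL1 L1L nL1] maxL1] := @max_dim _ _ reg ok _ ok0.
have maxL P : @stable _ _ reg P -> (L1 <= P)%VS -> (P <= L)%VS -> P = L1 \/ P = L.
  move=> sP L1P PL; have [->|nP] := eqVneq P L; [by right|left].
  apply/eqP; rewrite eq_sym eqEdim L1P; apply: maxL1.
  by split=> //; apply: subv_trans L1P.
pose I := (@ev _ _ reg e @^-1: L1)%VS.
have memI a : (a \in I) = (a * e \in L1) by rewrite -memv_preim evE.
have [p0 gp0 Ip0] : exists2 p, g p = u & forall a, a \in I -> act a p = 0.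
  apply: right_almost; first exact: (stable_preim (@ev_equivariant _ _ reg e)).
    move=> a; rewrite memI => /(subvP L1L)/(memv_relations _ _ ee)[_].
    by rewrite -actA eu.
  (* c e = e + z with z in the radical, and 1 + z is invertible *)
  move=> c cu cI; pose z := c * e - e.
  have ze : z * e = z by rewrite mulrBl -mulrA ee.
  have zu : act z u = 0 by rewrite actBl -actA eu cu subrr.
  have [v vz] : exists v, v * (1 + z) = 1.
    by apply: radical_unit; apply: Jin; rewrite ?zu ?mem0v.
  have vu : act v u = u.
    by rewrite -[X in act v X](addr0 u) -zu -[X in X + _]act1 -actDl actA vz act1.
  have vce : v * c * e = e.
    have -> : v * c * e = v * ((1 + z) * e).
      by rewrite mulrDl mul1r ze /z addrC subrK mulrA.
    by rewrite mulrA vz mul1r.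
  case/negP: nL1; rewrite eqEsubv L1L; apply/subvP => l.
  case/(memv_relations _ _ ee)=> le lu.
  have := cI (l * v); rewrite -actA vu lu => /(_ erefl).
  by rewrite memI (_ : l * v * c * e = l) // -[RHS]le -[X in _ = l * X]vce !mulrA.
pose p := act e p0; have ep : act e p = p by rewrite actA ee.
have gp : g p = u by rewrite eg gp0.
have L1p a : a \in L1 -> act a p = 0.
  move=> aL1; rewrite actA Ip0 // memI -mulrA ee.
  by have /(memv_relations _ _ ee)[-> _] := subvP L1L a aL1.
have /memv_sumP[w wW pE] : p \in (\sum_i W i)%VS by rewrite fullW memvf.
have {}wW i : w i \in W i by apply: wW.
have ew i : act e (w i) = w i.
  apply/eqP; rewrite -subr_eq0; apply/eqP.
  apply: (iW (t := fun i => act e (w i) - w i)) => [k|]; first by rewrite memvB // stW.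
  by rewrite sumrB -act_sumr -pE ep subrr.
have L1w i a : a \in L1 -> act a (w i) = 0.
  move=> aL1; apply: (iW (t := fun i => act a (w i))) => [k|]; first by rewrite stW.
  by rewrite -act_sumr -pE L1p.
have [i gwR] : exists i, g (w i) \notin R.
  apply: contrapT => no; case/negP: uR; rewrite -gp pE linear_sum memv_suml // => i _.
  by apply/negPn/negP => gwR; apply: no; exists i.
have wE : relations e (w i) = L1.
  apply: (relations_component ee gen eu uR) => //.
  apply/subvP => a aL1; apply/memv_relations => //; rewrite L1w //.
  by have /(memv_relations _ _ ee)[-> _] := subvP L1L a aL1.
have [T [sT TW]] := simple_summand.
have Tmin := unique_simple mQ dQ mn sT TW; have [_ nT _] := sT i.
have evW (P : {vspace A}) : (ev (w i) @: P <= W i)%VS.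
  by apply/subvP => _ /memv_imgP[a _ ->]; rewrite evE stW.
have stE (P : {vspace A}) : @stable _ _ reg P -> stable (ev (w i) @: P)%VS.
  by move=> sP; apply: stable_img (@ev_equivariant _ _ B (w i)) sP.
have Ve a : a \in V j -> a * e = a.
  by move=> aV; have /memVR[] := subvP (sumv_sup j erefl (subvv _)) a aV.
have TL : (T i <= ev (w i) @: L)%VS.
  apply: Tmin => //; first exact: stE.
  rewrite -lkerE; apply: contra nL1 => /subvP LK; rewrite eqEsubv L1L.
  apply/subvP => a aL; rewrite -wE; apply/memv_relations => //.
  have := LK a aL; rewrite memv_ker evE => /eqP ->.
  by have [-> _] := proj1 (memv_relations _ _ ee) aL.
have TV : (T i <= ev (w i) @: V j)%VS.
  apply: Tmin => //; first exact: stE.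
  rewrite -lkerE; apply: contra nR => /subvP VK; rewrite -subv0.
  apply: subv_trans Vj _; apply/subvP => _ /memv_imgP[a aV ->].
  have : a \in relations e (w i).
    by apply/memv_relations; rewrite // Ve //; have := VK a aV; rewrite memv_ker evE => /eqP.
  rewrite wE => /(subvP L1L)/(memv_relations _ _ ee)[_].
  by rewrite evE => ->; rewrite mem0v.
pose t := vpick (T i); have tT : t \in T i by exact: memv_pick.
have /memv_imgP[l lL tl] := subvP TL t tT.
have /memv_imgP[v vV tv] := subvP TV t tT.
have lvL1 : v - l \in L1.
  rewrite -wE; apply/memv_relations => //; split.
    by rewrite mulrBl Ve //; have [-> _] := proj1 (memv_relations _ _ ee) lL.
  by rewrite -evE linearB /= -tl -tv subrr.
have vL1 : v \in L1.
  apply: (subvP VL1); rewrite memv_cap vV andbT -[v](subrK l) memvD //.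
  exact: (subvP L1L).
by case/negP: nT; rewrite -vpick0 -/t tv evE L1w.
Qed.

End Core.

(** * Quotient modules *)

Section Quotients.
Variable R : nzRingType.

Lemma submoduleP (V : lmodType R) (S : set V) :
  submodule S <-> S 0 /\ forall a x y, S x -> S y -> S (a *: x + y).
Proof.
split=> [[S0 SD]|[S0 SD]]; split.
- exact: set_mem S0.
- by move=> a x y /mem_set Sx /mem_set Sy; apply: set_mem (SD a x y Sx Sy).
- exact: mem_set.
- by move=> a x y /set_mem Sx /set_mem Sy; apply/mem_set/SD.
Qed.

Section Construction.
Variables (V : lmodType R) (S : set V) (submS : submodule S).

Definition submodule_pred : {pred V} := [in S].

Fact submodule_pred_zmod : zmod_closed submodule_pred.
Proof. exact: GRing.submod_closedB submS. Qed.
HB.instance Definition _ :=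
  GRing.isZmodClosed.Build V submodule_pred submodule_pred_zmod.

Definition quotient : Type := @Quotient.quot V submodule_pred.
HB.instance Definition _ := GRing.Zmodule.on quotient.
Local Notation Q := quotient.
Let pi (x : V) : Q := (\pi x)%qT.

Let pi_eq x y : pi x = pi y <-> S (x - y).
Proof.
rewrite /pi; split=> [/eqP|Sxy]; last apply/eqP; rewrite -Quotient.idealrBE.
  exact: set_mem.
exact: mem_set.
Qed.

Definition quotient_scale (a : R) (y : Q) : Q := pi (a *: repr y).

Let pi_scale a x : quotient_scale a (pi x) = pi (a *: x).
Proof.
apply/pi_eq; rewrite -scalerBr; have [S0 SD] := proj1 (submoduleP S) submS.
rewrite -[_ *: _]addr0; apply: SD => //; apply/pi_eq.
by rewrite /pi reprK.
Qed.

Let pi_surj y : exists x, pi x = y.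
Proof. by exists (repr y); rewrite /pi reprK. Qed.

Let pi_add x y : pi (x + y) = pi x + pi y.
Proof. by rewrite /pi [LHS]raddfD. Qed.

Fact quotient_scaleA a b y :
  quotient_scale a (quotient_scale b y) = quotient_scale (a * b) y.
Proof. by have [x <-] := pi_surj y; rewrite !pi_scale scalerA. Qed.
Fact quotient_scale1 : left_id 1 quotient_scale.
Proof. by move=> y; have [x <-] := pi_surj y; rewrite pi_scale scale1r. Qed.
Fact quotient_scaleDr : right_distributive quotient_scale +%R.
Proof.
move=> a y z; have [x <-] := pi_surj y; have [x' <-] := pi_surj z.
by rewrite -pi_add !pi_scale scalerDr pi_add.
Qed.
Fact quotient_scaleDl y : {morph quotient_scale^~ y : a b / a + b}.
Proof.
by move=> a b; have [x <-] := pi_surj y; rewrite !pi_scale scalerDl pi_add.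
Qed.

HB.instance Definition _ := GRing.Zmodule_isLmodule.Build R Q
  quotient_scaleA quotient_scale1 quotient_scaleDr quotient_scaleDl.

Fact quotient_pi_linear : linear (pi : V -> Q).
Proof. by move=> a x y; rewrite pi_add -pi_scale. Qed.
HB.instance Definition _ := GRing.isLinear.Build R V Q _ pi quotient_pi_linear.

Lemma quotient_module :
  exists (F : lmodType R) (q : {linear V -> F}),
    (forall y, exists x, q x = y) /\ (forall x, q x = 0 <-> S x).
Proof.
exists Q, pi; split=> // x.
by rewrite -[0](linear0 pi) pi_eq subr0.
Qed.

End Construction.

Lemma factor_linear (E F G : lmodType R) (q : {linear E -> F})
    (h0 : {linear E -> G}) :
  (forall y, exists x, q x = y) -> (forall x, q x = 0 -> h0 x = 0) ->
  exists h : {linear F -> G}, forall x, h (q x) = h0 x.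
Proof.
move=> /choice[s sK] qh0; pose h y := h0 (s y).
have hq x : h (q x) = h0 x.
  apply/eqP; rewrite -subr_eq0 -linearB /= qh0 //.
  by rewrite linearB /= sK subrr.
have hL : linear h.
  by move=> a x y; rewrite -[x]sK -[y]sK -linearP /= !hq linearP.
pose hI := GRing.isLinear.Build R F G _ h hL.
by exists (HB.pack h hI : {linear F -> G}).
Qed.

Lemma scale_linear (V : lmodType R) (v : V) :
  exists h : {linear R^o -> V}, forall a, h a = (a : R) *: v.
Proof.
have hL : linear (fun a : R^o => (a : R) *: v).
  by move=> a b c; rewrite scalerDl -scalerA.
pose hI := GRing.isLinear.Build R R^o V _ _ hL.
by exists (HB.pack (fun a : R^o => (a : R) *: v) hI : {linear R^o -> V}).
Qed.

Lemma cyclic_linear (U V : lmodType R) (u : U) (v : V) :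
  (forall x, exists a, x = a *: u) -> (forall a, a *: u = 0 -> a *: v = 0) ->
  exists h : {linear U -> V}, h u = v.
Proof.
move=> gen annuv; have [hu huE] := scale_linear u; have [hv hvE] := scale_linear v.
have [||h hE] := @factor_linear _ _ _ hu hv.
- by move=> y; have [a ->] := gen y; exists a; rewrite huE.
- by move=> a; rewrite huE hvE; apply: annuv.
by exists h; have := hE 1; rewrite huE hvE !scale1r.
Qed.

End Quotients.

(** * From modules over A to finite-dimensional modules *)

Section Bridge.
Variables (K : fieldType) (A : falgType K).
Local Notation reg := (regmod A).

Definition module_iso (V : lmodType A) (M : fdmod A) (i : V -> M) (j : M -> V) :=
  [/\ cancel i j, cancel j i & forall a x y, i (a *: x + y) = act a (i x) + i y].

Lemma module_iso_regular : @module_iso A^o reg id id.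
Proof. by []. Qed.

(** A module with n generators is a quotient of A^n; a complement of the kernel
    carries it. *)
Lemma finitely_generated_iso (V : lmodType A) : finitely_generated V ->
  exists (M : fdmod A) (i : V -> M) (j : M -> V), module_iso i j.
Proof.
move=> [n [gen genV]]; pose F := {ffun 'I_n -> A}.
pose pi (f : F) : V := \sum_i f i *: gen i.
have piD f f' : pi (f + f') = pi f + pi f'.
  by rewrite -big_split; apply: eq_bigr => i _; rewrite ffunE scalerDl.
have piZ k f : pi (k *: f) = k%:A *: pi f.
  by rewrite scaler_sumr; apply: eq_bigr => i _; rewrite ffunE scalerA mulr_algl.
have pi0 : pi 0 = 0 by rewrite /pi big1 // => i _; rewrite ffunE scale0r.
pose W := vset (fun f : F => pi f = 0).
have memW f : f \in W <-> pi f = 0.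
  apply: memv_vset; split=> // k x y x0 y0.
  by rewrite piD piZ x0 y0 scaler0 addr0.
pose C := subvs_of (W^C)%VS; pose j (y : C) : V := pi (vsval y).
have jsurj x : exists y, j y = x.
  have [f ->] := genV x.
  have : [ffun i => f i] \in (W + W^C)%VS by rewrite addv_complf memvf.
  case/memv_addP=> w wW [c cC E]; exists (Subvs cC).
  have -> : \sum_i f i *: gen i = pi (w + c).
    by rewrite -E /pi; apply: eq_bigr => k _; rewrite ffunE.
  by rewrite piD (proj1 (memW w) wW) add0r.
have jinj : injective j.
  move=> y y' E; apply/val_inj/eqP; rewrite -subr_eq0 -memv0 -(capv_compl W) memv_cap.
  apply/andP; split; last by rewrite memvB ?subvsP.
  apply/memW; rewrite piD -scaleN1r piZ -/(j y) E /j -[in X in X + _](scale1r (pi _)).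
  by rewrite scaleN1r -scalerDl addrN scale0r.
have /choice[i iK] := jsurj.
have jK : cancel j i by move=> y; apply: jinj; rewrite iK.
have jL k (y y' : C) : j (k *: y + y') = k%:A *: j y + j y'.
  by rewrite /j linearP /= piD piZ.
have iL k x x' : i (k%:A *: x + x') = k *: i x + i x'.
  by apply: jinj; rewrite jL !iK.
pose actM (a : A) (y : C) : C := i (a *: j y).
have act1' y : actM 1 y = y by rewrite /actM scale1r jK.
have actA' a b y : actM a (actM b y) = actM (a * b) y.
  by rewrite /actM iK scalerA.
have actl y : linear (fun a : A => actM a y).
  by move=> k a b; rewrite /actM scalerDl -iL scalerA mulr_algl.
have actr a : linear (actM a).
  by move=> k y y'; rewrite /actM jL scalerDr -iL !scalerA mulr_algl mulr_algr.
exists (Fdmod act1' actA' actl actr), i, j; split=> // a x y.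
by apply: jinj; rewrite -[act _ _]scale1r jL !iK !scale1r.
Qed.

Section Submodules.
Variables (V : lmodType A) (M : fdmod A) (i : V -> M) (j : M -> V).
Hypothesis ij : module_iso i j.

Lemma isoK : cancel i j. Proof. by case: ij. Qed.
Lemma isoVK : cancel j i. Proof. by case: ij. Qed.
Lemma iso_lin a x y : i (a *: x + y) = act a (i x) + i y.
Proof. by case: ij. Qed.
Lemma isoD x y : i (x + y) = i x + i y.
Proof. by rewrite -[x]scale1r iso_lin act1 scale1r. Qed.
Lemma iso0 : i 0 = 0.
Proof. by apply: (addrI (i 0)); rewrite -isoD !addr0. Qed.
Lemma isoZ a x : i (a *: x) = act a (i x).
Proof. by rewrite -[a *: x]addr0 iso_lin iso0 addr0. Qed.
Lemma isoVZ a y : j (act a y) = a *: j y.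
Proof. by apply: (can_inj isoK); rewrite isoVK isoZ isoVK. Qed.
Lemma isoVD x y : j (x + y) = j x + j y.
Proof. by apply: (can_inj isoK); rewrite isoVK isoD !isoVK. Qed.
Lemma isoV0 : j 0 = 0.
Proof. by apply: (can_inj isoK); rewrite isoVK iso0. Qed.
Lemma isoVZ_scalar k y : j (k *: y) = k%:A *: j y.
Proof. by rewrite -isoVZ actZl act1. Qed.

Definition to_vspace (S : set V) : {vspace M} := vset (fun y => S (j y)).
Definition of_vspace (W : {vspace M}) : set V := [set x | i x \in W].

Lemma memv_to_vspace S y : submodule S -> y \in to_vspace S <-> S (j y).
Proof.
move=> /submoduleP[S0 SD]; apply: memv_vset; split=> [|k x z Sx Sz].
  by rewrite isoV0.
by rewrite isoVD isoVZ_scalar; apply: SD.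
Qed.

Lemma stable_to_vspace S : submodule S -> stable (to_vspace S).
Proof.
move=> sS a y /(memv_to_vspace _ sS) Sy; apply/memv_to_vspace => //.
have /submoduleP[S0 SD] := sS.
by rewrite isoVZ -[_ *: _]addr0; apply: SD.
Qed.

Lemma submodule_of_vspace W : stable W -> submodule (of_vspace W).
Proof.
move=> sW; apply/submoduleP; split; first by rewrite /of_vspace /= iso0 mem0v.
by move=> a x y xW yW; rewrite /of_vspace /= iso_lin memvD ?sW.
Qed.

Lemma to_vspaceK S : submodule S -> of_vspace (to_vspace S) = S.
Proof.
move=> sS; apply/seteqP; split=> x /=.
  by rewrite /of_vspace /= => /(memv_to_vspace _ sS); rewrite isoK.
by move=> Sx; apply/(memv_to_vspace _ sS); rewrite isoK.
Qed.

Lemma of_vspaceS W W' : (of_vspace W `<=` of_vspace W')%classic <-> (W <= W')%VS.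
Proof.
split=> [le|/subvP le x]; last exact: le.
by apply/subvP => y yW; have := le (j y); rewrite /of_vspace /= isoVK; apply.
Qed.

Lemma of_vspace_inj : injective of_vspace.
Proof.
move=> W W' E; apply/eqP; rewrite eqEsubv.
by apply/andP; split; apply/of_vspaceS; rewrite E.
Qed.

Lemma to_vspaceE S : submodule S -> exists2 W, stable W & S = of_vspace W.
Proof.
move=> sS; exists (to_vspace S); first exact: stable_to_vspace.
by rewrite to_vspaceK.
Qed.

Lemma of_vspace0 : of_vspace 0%VS = [set 0]%classic.
Proof.
apply/seteqP; split=> x /=; rewrite /of_vspace /= memv0.
  by move=> /eqP ix; rewrite -[x]isoK ix isoV0.
by move=> ->; rewrite iso0.
Qed.

(** A submodule of least dimension above P is the next term. *)
Lemma composition_path (P Q : {vspace M}) :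
  stable P -> stable Q -> (P <= Q)%VS ->
  exists s : seq (set V),
    path (fun S T => `[< simple_factor S T >]) (of_vspace P) s /\
    last (of_vspace P) s = of_vspace Q.
Proof.
move=> sP sQ; move: {2}(\dim Q - \dim P)%N (leqnn (\dim Q - \dim P)) => n.
elim: n P sP => [|n IH] P sP le PQ; have [QP|nQP] := boolP (Q <= P)%VS;
  try by exists [::]; split=> //=; congr of_vspace; apply/eqP; rewrite eqEsubv PQ.
- case/negP: nQP; rewrite -(dimv_leqif_sup PQ) eqn_leq dimvS //=.
  by rewrite -subn_eq0 -leqn0.
pose ok (T : {vspace M}) := [/\ stable T, (P <= T)%VS, ~~ (T <= P)%VS & (T <= Q)%VS].
have [T [sT PT nTP TQ] minT] := @min_dim _ _ _ ok Q (And4 sQ PQ nQP (subvv Q)).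
have ltPT : (\dim P < \dim T)%N.
  by rewrite ltn_neqAle dimvS // andbT (dimv_leqif_sup PT).
have leTQ : (\dim Q - \dim T <= n)%N.
  rewrite -ltnS; apply: leq_trans le; apply: ltn_sub2l => //.
  exact: leq_trans ltPT (dimvS TQ).
have [s [sp sl]] := IH T sT leTQ TQ.
exists (of_vspace T :: s); split=> //=; rewrite sp andbT; apply/asboolP; split.
- exact: submodule_of_vspace.
- exact: submodule_of_vspace.
- by split; [apply/of_vspaceS|move/of_vspaceS; apply/negP].
move=> S sS; have [W sW ->] := to_vspaceE sS.
move=> /of_vspaceS PW /of_vspaceS WT; have [WP|nWP] := boolP (W <= P)%VS.
  by left; congr of_vspace; apply/eqP; rewrite eqEsubv WP.
right; congr of_vspace; apply/eqP; rewrite eqEdim WT minT //.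
by split=> //; apply: subv_trans TQ.
Qed.

Lemma path_subset (S : set V) (s : seq (set V)) :
  path (fun P Q => `[< simple_factor P Q >]) S s -> (S `<=` last S s)%classic.
Proof.
elim: s S => [S _ x //|T s IH] S /= /andP[/asboolP[_ _ [ST _] _] /IH].
exact: subset_trans ST.
Qed.

(** Every submodule of a uniserial module is a term of the composition series,
    since a series can be refined to pass through it. *)
Lemma serial_to_vspace S : uniserial_submodule S -> serial 0 (to_vspace S).
Proof.
move=> [sS [s0 [_ uniq0]]] W W' sW sW' /andP[_ WS] /andP[_ WS'].
have stS := stable_to_vspace sS.
have series P : stable P -> (P <= to_vspace S)%VS -> exists s t,
    [/\ s0 = s ++ t, last [set 0]%classic s = of_vspace P &
      path (fun P Q => `[< simple_factor P Q >]) [set 0]%classic s0].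
  move=> sP PS; have [s [sp sl]] := composition_path (@stable0 _ _ M) sP (sub0v P).
  have [t [tp tl]] := composition_path sP stS PS.
  rewrite of_vspace0 in sp sl.
  have E : s0 = s ++ t.
    apply: uniq0; split; last by rewrite last_cat sl tl to_vspaceK.
    by rewrite cat_path sp sl.
  by exists s, t; rewrite E cat_path sp sl.
have [s [t [sE sl p0]]] := series W sW WS.
have [s' [t' [sE' sl' _]]] := series W' sW' WS'.
(* of two initial segments of the series, one extends the other *)
have main (P P' : {vspace M}) (r r' q q' : seq (set V)) : s0 = r ++ q -> s0 = r' ++ q' ->
    last [set 0]%classic r = of_vspace P -> last [set 0]%classic r' = of_vspace P' ->
    (size r <= size r')%N -> (P <= P')%VS.
  move=> rE rE' rl rl' le; apply/of_vspaceS; rewrite -rl -rl'.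
  have r'E : r' = r ++ drop (size r) r'.
    have tr : take (size r) r' = r by rewrite -(takel_cat q' le) -rE' rE take_size_cat.
    by rewrite -{1}(cat_take_drop (size r) r') tr.
  rewrite {1}r'E last_cat; apply: path_subset.
  have := p0; rewrite rE' {1}r'E -catA cat_path => /andP[_].
  by rewrite cat_path => /andP[].
case/orP: (leq_total (size s) (size s')) => le; [left|right].
  exact: main sE sE' sl sl' le.
exact: main sE' sE sl' sl le.
Qed.

End Submodules.
End Bridge.

Section AlmostSplit.
Variables (K : fieldType) (A : falgType K) (X B U : lmodType A).
Variables (f : {linear X -> B}) (g : {linear B -> U}).
Hypothesis ass : almost_split_sequence f g.
Variables (M : fdmod A) (i : B -> M) (j : M -> B).
Variables (N : fdmod A) (i' : U -> N) (j' : N -> U).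
Hypotheses (ij : module_iso i j) (ij' : module_iso i' j').

Definition transport (y : M) : N := i' (g (j y)).

Fact transport_linear : linear transport.
Proof.
move=> k x y; rewrite /transport (isoVD ij) (isoVZ_scalar ij) linearD linearZ /=.
by rewrite (isoD ij') (isoZ ij') actZl act1.
Qed.
HB.instance Definition _ := GRing.isLinear.Build K M N _ transport transport_linear.

Definition transport_lfun : 'Hom(M, N) := linfun transport.
Local Notation h := transport_lfun.

Lemma transportE y : h y = i' (g (j y)). Proof. exact: lfunE. Qed.

Lemma transport_equivariant : equivariant h.
Proof. by move=> a y; rewrite !transportE (isoVZ ij) linearZ (isoZ ij'). Qed.

Lemma transport_surj y : exists p, h p = y.
Proof.
have [_ _ _ [_ gs _] _] := ass; have [b bE] := gs (j' y).
by exists (i b); rewrite transportE (isoK ij) bE (isoVK ij').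
Qed.

Lemma cyc_generates y : (fullv <= cyc y)%VS -> forall x : U, exists a, x = a *: j' y.
Proof.
move=> /subvP full x; have /memv_cyc[a aE] := full (i' x) (memvf _).
by exists a; rewrite -(isoVZ ij') -aE (isoK ij').
Qed.

Lemma iso_act0 y a : act a y = 0 <-> a *: j' y = 0.
Proof.
rewrite -(isoVZ ij'); split=> [->|/(congr1 i')]; first by rewrite (isoV0 ij').
by rewrite (isoVK ij') (iso0 ij').
Qed.

(** The section sends a generator of U to the given preimage. *)
Lemma transport_nonsplit y p : (fullv <= cyc y)%VS -> h p = y ->
  ~ (forall a, act a y = 0 -> act a p = 0).
Proof.
move=> full; rewrite transportE => py annyp; have [_ _ _ _ [_ [nsplit _]]] := ass.
have gp : g (j p) = j' y by rewrite -py (isoK ij').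
have [s sE] := @cyclic_linear _ _ _ (j' y) (j p) (cyc_generates full)
  (fun a ay => etrans (esym (isoVZ ij a p))
     (etrans (congr1 j (annyp a (proj2 (iso_act0 y a) ay))) (isoV0 ij))).
apply: nsplit; exists s => x; have [a ->] := cyc_generates full x.
by rewrite !linearZ /= sE gp.
Qed.

(** The map X -> X / Y is not a split monomorphism, hence it factors through B;
    subtracting an element of X from a preimage of y puts it in the kernel of
    B -> X / Y. *)
Lemma transport_left Y : stable Y -> Y != 0%VS -> (Y <= lker h)%VS ->
  forall y, exists2 p, h p = y & forall a, act a y = 0 -> act a p \in Y.
Proof.
move=> sY nY /subvP Yk y.
have [[nX [genX genXE]] _ _ [finj gs gk] [[_ las] _]] := ass.
pose S : set X := [set x | i (f x) \in Y]%classic.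
have submS : submodule S.
  apply/submoduleP; split; first by rewrite /S /= linear0 (iso0 ij) mem0v.
  by move=> a x z xS zS; rewrite /S /= linearP (iso_lin ij) memvD ?sY.
have [Q [q [qsurj qker]]] := quotient_module submS.
have fgQ : finitely_generated Q.
  exists nX, (fun k => q (genX k)) => z; have [x <-] := qsurj z.
  have [a ->] := genXE x; exists a; rewrite linear_sum.
  by apply: eq_bigr => k _; rewrite linearZ.
have nsplit : ~ split_mono q.
  case=> r rq; case/negP: nY; rewrite -vpick0; have pY := memv_pick Y.
  have gp : g (j (vpick Y)) = 0.
    have := Yk _ pY; rewrite memv_ker transportE => /eqP/(congr1 j').
    by rewrite (isoK ij') (isoV0 ij').
  have [x fx] := proj1 (gk _) gp.
  have Sx : S x by rewrite /S /= fx (isoVK ij).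
  have x0 : x = 0 by rewrite -[x]rq (proj2 (qker x) Sx) linear0.
  by rewrite -(isoVK ij (vpick Y)) -fx x0 linear0 (iso0 ij).
have [k kE] := las Q q fgQ nsplit.
have [b0 gb0] := gs (j' y); have [x0 qx0] := qsurj (k b0).
have gf x : g (f x) = 0 by apply/gk; exists x.
exists (i (b0 - f x0)).
  by rewrite transportE (isoK ij) linearB /= gb0 gf subr0 (isoVK ij').
move=> a /iso_act0 ay; rewrite -(isoZ ij).
have [x fx] : exists x, f x = a *: (b0 - f x0).
  by apply/gk; rewrite linearZ linearB /= gb0 gf subr0.
rewrite -fx; apply/(qker x).
by rewrite -kE fx linearZ linearB /= kE qx0 subrr scaler0.
Qed.

(** A section of A / I -> U would be given by an element c, so the hypothesis
    says that this map is not split; p is the image of 1 under a lift to B. *)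
Lemma transport_right y (I : {vspace A}) : @stable _ _ (regmod A) I ->
  (forall a, a \in I -> act a y = 0) ->
  (forall c, act c y = y -> ~ forall a, act a y = 0 -> a * c \in I) ->
  exists2 p, h p = y & forall a, a \in I -> act a p = 0.
Proof.
move=> sI Iy nsplit; have [_ _ _ _ [_ [_ ras]]] := ass.
have submI : submodule (of_vspace (id : A^o -> regmod A) I).
  exact: (submodule_of_vspace (module_iso_regular A)).
have [Q [q [qsurj qker]]] := quotient_module submI.
have [h0 h0E] := scale_linear (j' y).
have [|l lE] := @factor_linear _ _ _ _ q h0 qsurj.
  by move=> a /qker aI; rewrite h0E; apply/iso_act0/Iy.
have fgQ : finitely_generated Q.
  exists 1%N, (fun=> q 1) => z; have [x <-] := qsurj z; exists (fun=> (x : A)).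
  by rewrite big_ord1 -linearZ /= /GRing.scale /= mulr1.
have q1 a : q (a : A^o) = (a : A) *: q 1 by rewrite -linearZ /= /GRing.scale /= mulr1.
have nsl : ~ split_epi l.
  case=> s sl; have [c cE] := qsurj (s (j' y)); apply: (nsplit c).
    by apply: (can_inj (isoVK ij')); rewrite (isoVZ ij') -h0E -lE cE sl.
  move=> a /iso_act0 ay; apply/(qker (a * c : A^o)).
  by rewrite q1 -scalerA -q1 cE -linearZ /= ay linear0.
have [k kE] := ras Q l fgQ nsl; exists (i (k (q 1))).
  by rewrite transportE (isoK ij) kE lE h0E scale1r (isoVK ij').
move=> a aI; rewrite -(isoZ ij) -linearZ /= -q1 (proj2 (qker a) aI).
by rewrite linear0 (iso0 ij).
Qed.

End AlmostSplit.

Section Rings.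
Variables (K : fieldType) (A : falgType K).
Local Notation reg := (regmod A).
Local Notation isoA := (module_iso_regular A).
Local Notation ideal := (of_vspace (id : A^o -> regmod A)).

Lemma maximal_ideal (I : {vspace A}) : maxideal I -> maximal_submodule (ideal I).
Proof.
move=> mI; have [sI n1 _] := mI; split; first exact: (submodule_of_vspace isoA).
  by apply/eqP => E; case/negP: n1; have : ideal I 1 by rewrite E.
move=> T sT; have [W sW ->] := to_vspaceE isoA sT => /(of_vspaceS isoA) IW.
have [W1|nW1] := boolP ((1 : A) \in W).
  right; apply/seteqP; split=> // x _; rewrite /of_vspace /=.
  by rewrite -[x]mulr1; apply: (sW x).
by left; congr of_vspace; apply: (maxideal_eq mI).
Qed.

Lemma maximal_ideal_to (S : set A^o) :
  maximal_submodule S -> exists2 I, maxideal I & S = ideal I.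
Proof.
move=> [sS /eqP nS maxS]; have [I sI SE] := to_vspaceE isoA sS.
exists I => //; have n1 : (1 : A) \notin I.
  apply/negP => I1; apply: nS; rewrite SE; apply/seteqP; split=> // x _.
  by rewrite /of_vspace /= -[x]mulr1; apply: (sI x).
have [I' mI' II'] := maxideal_exists sI n1; have [sI' n1' _] := mI'.
have [||E|E] := maxS (ideal I').
- exact: (submodule_of_vspace isoA).
- by rewrite SE; apply/(of_vspaceS isoA).
- suff -> : I = I' by [].
  by apply: (of_vspace_inj isoA); rewrite E.
- by case/negP: n1'; have : ideal I' 1 by rewrite E.
Qed.

Lemma in_radicalP (x : A) : in_radical x <-> @jacobson_radical A x.
Proof.
split=> [xJ S /maximal_ideal_to[I mI ->]|xJ I mI]; first exact: xJ.
exact: xJ (maximal_ideal mI).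
Qed.

Lemma multiserial_vspace m : left_multiserial A m ->
  forall e : A, primitive_idempotent e ->
  exists V : 'I_m -> {vspace A},
    [/\ forall i, @stable _ _ reg (V i), forall i, @serial _ _ reg 0 (V i) &
        forall a, a \in (\sum_i V i)%VS <-> exists2 x, in_radical x & a = x * e].
Proof.
move=> mA e pe; have [W [uW WE]] := mA e pe.
pose V k := to_vspace (id : reg -> A^o) (W k).
have sW k : submodule (W k) by have [] := uW k.
have memV k a : a \in V k <-> W k a := memv_to_vspace isoA a (sW k).
exists V; split=> [k|k|a].
- exact: (stable_to_vspace isoA).
- exact: (serial_to_vspace isoA).
have sumE : a \in (\sum_i V i)%VS <-> sum_submodules W a.
  split=> [/memv_sumP[w wV ->]|[w wW <-]].
    by exists w => // k; apply/memV/wV.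
  by apply: memv_sumr => k _; apply/memV/wW.
rewrite sumE -WE; split=> [[x xJ <-]|[x xJ ->]]; exists x => //; exact/in_radicalP.
Qed.

End Rings.

Theorem theorem6p5 (K : fieldType) (A : falgType K) (m : nat)
    (hm : (2 <= m)%N) (hA : left_multiserial A m)
    (U : lmodType A) (fgU : finitely_generated U) (uniU : uniserial U)
    (nprojU : ~ projective U) (n : nat) (hn : alpha U n) :
  (n <= m)%N.
Proof.
have [X [B [f [g [W [ass [indW sumW indepW]]]]]]] := hn.
have [_ fgB _ _ _] := ass.
have [M [i [j ij]]] := finitely_generated_iso fgB.
have [N [i' [j' ij']]] := finitely_generated_iso fgU.
have sW k : submodule (W k) by have [] := indW k.
pose V k := to_vspace j (W k).
have memV k y : y \in V k <-> W k (j y) := memv_to_vspace ij y (sW k).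
apply (@summands_le_multiserial K A M N (transport_lfun g j i') n m V).
- exact: (transport_equivariant g ij ij').
- exact: (transport_surj ass ij ij').
- by move=> k; apply: (stable_to_vspace ij).
- move=> k; apply/eqP => V0; have [_ /eqP nW _] := indW k; apply: nW.
  by rewrite -(to_vspaceK ij (sW k)) -/(V k) V0 (of_vspace0 ij).
- move=> t tV t0 k; apply: (can_inj (isoVK ij)); rewrite (isoV0 ij).
  apply: (indepW (fun k => j (t k))) => [l|]; first exact/memV/tV.
  have j_sum (r : seq 'I_n) : \sum_(l <- r) j (t l) = j (\sum_(l <- r) t l).
    elim: r => [|l r IH]; first by rewrite !big_nil (isoV0 ij).
    by rewrite !big_cons IH (isoVD ij).
  by rewrite j_sum t0 (isoV0 ij).
- apply/eqP; rewrite eqEsubv subvf /=; apply/subvP => y _.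
  have : sum_submodules W (j y) by rewrite sumW.
  case=> w wW wE; rewrite -(isoVK ij y) -wE.
  have i_sum (r : seq 'I_n) : i (\sum_(l <- r) w l) = \sum_(l <- r) i (w l).
    elim: r => [|l r IH]; first by rewrite !big_nil (iso0 ij).
    by rewrite !big_cons (isoD ij) IH.
  rewrite i_sum; apply: memv_sumr => k _.
  by apply/memV; rewrite (isoK ij); apply: wW.
- suff -> : fullv = to_vspace j' [set: U]%classic by exact: (serial_to_vspace ij' uniU).
  have [sU _] := uniU.
  apply/eqP; rewrite eq_sym eqEsubv subvf /=; apply/subvP => y _.
  exact/(memv_to_vspace ij' y sU).
- exact: (transport_nonsplit ass ij ij').
- exact: (transport_left ass ij ij').
- exact: (transport_right ass ij ij').
- exact: (multiserial_vspace hA).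
- exact: hm.
Qed.
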